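(* Let $\alpha>0$, let $\mu$ be a positive Borel measure on $\mathbb{C}$, let $p\ge 1$ and $r>0$, and let $\{a_n\}_{n\ge 1}$ be an enumeration of the lattice $r\mathbb{Z}^2$ in $\mathbb{C}$. Then the following conditions are equivalent. (a) There exists a constant $C$ such that $\mu(B(z,r))\le C$ for all $z\in\mathbb{C}$; in particular, $\mu(B(a_n,r))\le C$ for all $n\in\mathbb{Z}^+$. (b) There exists a constant $C>0$ such that for all $f\in F^p_h$, $$\int_{\mathbb{C}}\left|f(\omega)e^{-\frac{\alpha|\omega|^2}{2}}\right|^p d\mu(\omega)\le C\int_{\mathbb{C}}\left|f(\omega)e^{-\frac{\alpha|\omega|^2}{2}}\right|^p dA(\omega).$$ (c) The function $\widetilde{\mu}(z)$ is bounded on $\mathbb{C}$.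
   Context: Here $dA$ is area (Lebesgue) measure on $\mathbb{C}$, $B(z,r)=\{\omega\in\mathbb{C}:|\omega-z|<r\}$, and $r\mathbb{Z}^2=\{nr+imr: n,m\in\mathbb{Z}\}$. The harmonic Fock space $F^p_h$ is the space of all (complex-valued) harmonic functions $f$ on $\mathbb{C}$ with $\int_{\mathbb{C}}|f(z)e^{-\alpha|z|^2/2}|^p dA(z)<\infty$. For $z\in\mathbb{C}$ put $k_z(\omega)=e^{\alpha\bar z\omega-\frac{\alpha}{2}|z|^2}$ and $h_z(\omega)=\frac{\sqrt2}{2}\left(k_z(\omega)+\overline{k_z(\omega)}\right)$. The Berezin transform of $\mu$ is $\widetilde{\mu}(z)=\int_{\mathbb{C}}|h_z(u)|^2e^{-\alpha|u|^2}d\mu(u)$. *)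

(* Defs.v *)
From HB Require Import structures.
From mathcomp Require Import all_boot all_order all_algebra.
From mathcomp Require Import complex.
From mathcomp Require Import all_classical all_reals all_analysis.

Set Implicit Arguments.
Unset Strict Implicit.
Unset Printing Implicit Defensive.

Import Order.TTheory GRing.Theory Num.Theory.
Import numFieldNormedType.Exports.
Import Normc.

Local Open Scope classical_set_scope.
Local Open Scope ring_scope.
Local Open Scope complex_scope.

(* Points of the complex plane are pairs [(x, y)] standing for [x + i y], and
   complex arithmetic takes place in [R[i]]. [plane R] is [R * R] with the
   product of the two Borel sigma-algebras, which is the Borel sigma-algebra of
   the plane. The norm and the balls of the library on [R * R] are those of the
   sup norm, so that moduli and discs go through [normc]. *)
Definition plane (R : realType) := (measurableTypeR R * measurableTypeR R)%type.

Definition cplx (R : realType) (z : R * R) : R[i] := z.1 +i* z.2.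

Definition area (R : realType) : {measure set (plane R) -> \bar R} :=
  (@lebesgue_measure R \x @lebesgue_measure R)%E.

Definition disc (R : realType) (z : R * R) (r : R) : set (R * R) :=
  [set w | normc (cplx w - cplx z) < r].

Definition square_lattice (R : realType) (r : R) : set (R * R) :=
  [set z | exists n m : int, cplx z = (n%:~R * r) +i* (m%:~R * r)].

Definition partial_x (R : realType) (u : R * R -> R) : R * R -> R :=
  fun z => 'D_(1, 0) u z.

Definition partial_y (R : realType) (u : R * R -> R) : R * R -> R :=
  fun z => 'D_(0, 1) u z.

Definition C1 (R : realType) (u : R * R -> R) : Prop :=
  [/\ forall z, derivable u z (1, 0), forall z, derivable u z (0, 1),
      continuous (partial_x u) & continuous (partial_y u)].

Definition real_harmonic (R : realType) (u : R * R -> R) : Prop :=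
  [/\ C1 u, C1 (partial_x u), C1 (partial_y u) &
      forall z, partial_x (partial_x u) z + partial_y (partial_y u) z = 0].

Definition complex_harmonic (R : realType) (f : R * R -> R[i]) : Prop :=
  real_harmonic (fun z => complex.Re (f z)) /\
  real_harmonic (fun z => complex.Im (f z)).

Definition cexp (R : realType) (z : R[i]) : R[i] :=
  (expR (complex.Re z))%:C * (cos (complex.Im z) +i* sin (complex.Im z)).

Definition weighted_pow (R : realType) (alpha p : R) (f : R * R -> R[i])
    (w : R * R) : \bar R :=
  (normc (f w * (expR (- (alpha * normc (cplx w) ^+ 2 / 2)))%:C) `^ p)%:E.

Definition harmonic_fock (R : realType) (alpha p : R) : set (R * R -> R[i]) :=
  [set f | complex_harmonic f /\
    (\int[area R]_w weighted_pow alpha p f w < +oo)%E].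

Definition kz (R : realType) (alpha : R) (z w : R * R) : R[i] :=
  cexp (alpha%:C * conjc (cplx z) * cplx w
        - (alpha / 2 * normc (cplx z) ^+ 2)%:C).

Definition hz (R : realType) (alpha : R) (z w : R * R) : R[i] :=
  (Num.sqrt 2 / 2)%:C * (kz alpha z w + conjc (kz alpha z w)).

Definition berezin (R : realType) (alpha : R)
    (mu : {measure set (plane R) -> \bar R}) (z : R * R) : \bar R :=
  (\int[mu]_u (normc (hz alpha z u) ^+ 2
               * expR (- (alpha * normc (cplx u) ^+ 2)))%:E)%E.

(* Main.v *)
Require Import Defs.
From HB Require Import structures.
From mathcomp Require Import all_boot all_order all_algebra.
From mathcomp Require Import complex ring lra.
From mathcomp Require Import all_classical all_reals all_analysis.
From mathcomp Require Import measurable_realfun.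
Import Order.TTheory GRing.Theory Num.Theory.
Import numFieldNormedType.Exports.
Local Open Scope classical_set_scope.
Local Open Scope ring_scope.

(** Write [g w = |f w| exp (- alpha |w|^2 / 2)]. The heart of the matter is
    that a harmonic [f] satisfies
      [g w ^ p <= C * \int_{D(w, r)} g ^ p dA]
    with a constant independent of [w] ([harmonic_power_average]). For
    holomorphic [f] this is the submean inequality applied to
    [f(z) exp (- alpha conj(w) z)]; it is not immediate for harmonic [f],
    because the weight changes by a factor [exp (alpha |w|)] across the disc
    and holomorphic and antiholomorphic parts call for opposite twists.

    The estimate is obtained in two steps for a real harmonic [u]. Its complex
    gradient [u_x - i u_y] is holomorphic, so the twist by
    [exp (- alpha conj(w) (z - w))] and the mean value property express it at
    [w] as an area integral; integrating by parts puts the derivative on the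
    kernel, at the price of a factor [1 + alpha |w|]:
      [|grad u (w)| weight(w) <= C (1 + alpha |w|) \int_{D(w, r/2)} |u| weight]
    ([gradient_estimate_dir]). Then [u w] is compared with [u z] for [z] in a
    small square on the side of [w] facing the origin. Along the segment from
    [w] to [z] the ratio of weights decays like [exp (- c |w| s)], and the
    integral over [s] of this exponential absorbs the factor [1 + |w|]
    ([pointwise_step]). Averaging over the square gives the case [p = 1]
    ([harmonic_pointwise]), and Young's inequality gives the other powers.

    Integrating against [mu] and exchanging the integrals turns a uniform bound
    on the masses of discs into the embedding inequality, for every [p >= 1]
    ([carleson_embedding]). Conversely the holomorphic functions [k_z] are
    harmonic and have Gaussian modulus [exp (- alpha |w - z|^2 / 2)] after
    weighting, so the embedding inequality for one exponent bounds the masses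
    of discs ([disc_mass_of_gaussian_mass]). Passing through disc masses changes
    the exponent from [p] to [2], which bounds the Berezin transform.

    Finally, [|h_z|^2 exp (- alpha |u|^2)] is
    [2 exp (- alpha |u - z|^2) cos^2 (alpha Im (conj(z) u))], which vanishes on
    lines through any disc far from the origin. Moving [z] by
    [i pi z / (2 alpha |z|^2)] shifts the phase by about a quarter period, so
    the sum of the two integrands is bounded below on the disc
    ([disc_mass_of_berezin]). *)

Set Implicit Arguments.
Unset Strict Implicit.
Unset Printing Implicit Defensive.

(** * Continuously differentiable functions on the plane *)

Section calculus.
Context {R : realType}.
Implicit Types (u v : R * R -> R) (z w : R * R).

(** Stating partial derivatives as one-variable derivatives of slices makes the calculus
    and integration lemmas on the line applicable. *)
Definition pdx u (ux : R * R -> R) :=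
  forall x y, is_derive x (1 : R) (fun t : R => u (t, y)) (ux (x, y)).
Definition pdy u (uy : R * R -> R) :=
  forall x y, is_derive y (1 : R) (fun t : R => u (x, t)) (uy (x, y)).
(** The partial derivatives are arguments, so that a lemma can exhibit them as
    explicit functions. *)
Definition gradc u ux uy :=
  [/\ pdx u ux, pdy u uy, continuous ux & continuous uy].

Lemma derivable_pdx u : (forall z, derivable u z (1, 0)) -> pdx u (partial_x u).
Proof.
move=> du x y.
have E : (fun h : R => h^-1 *: (u (h *: ((1 : R), (0 : R)) + (x, y)) - u (x, y)))
  = (fun h => h^-1 *: ((fun t => u (t, y)) (h *: 1 + x) - u (x, y))).
  apply/funext => h; congr (_ *: (u _ - _)).
  by apply: injective_projections; rewrite /= ?scaler0 ?add0r.
have := du (x, y); rewrite /derivable E => d.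
split; first exact: d.
by rewrite /derive /partial_x /derive E.
Qed.

Lemma derivable_pdy u : (forall z, derivable u z (0, 1)) -> pdy u (partial_y u).
Proof.
move=> du x y.
have E : (fun h : R => h^-1 *: (u (h *: ((0 : R), (1 : R)) + (x, y)) - u (x, y)))
  = (fun h => h^-1 *: ((fun t => u (x, t)) (h *: 1 + y) - u (x, y))).
  apply/funext => h; congr (_ *: (u _ - _)).
  by apply: injective_projections; rewrite /= ?scaler0 ?add0r.
have := du (x, y); rewrite /derivable E => d.
split; first exact: d.
by rewrite /derive /partial_y /derive E.
Qed.

(** A form of the mean value theorem that needs no case split on the sign of
    the increment. *)
Lemma MVT_sym (f df : R -> R) (a h : R) :
  (forall x, is_derive x (1 : R) f (df x)) ->
  exists2 c, `|c - a| <= `|h| & f (a + h) - f a = df c * h.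
Proof.
move=> dfE.
have cf c d : {within `[c, d], continuous f}.
  apply: derivable_within_continuous => x _; exact: ex_derive.
have [h0|h0|->] := ltrgtP h 0.
- have [//||c] := @MVT _ f df (a + h) a; first by lra.
    exact: cf.
  rewrite in_itv /= => /andP[c1 c2] E; exists c.
    by rewrite (ltr0_norm h0) ltr0_norm; lra.
  by rewrite -opprB E; lra.
- have [//||c] := @MVT _ f df a (a + h); first by lra.
    exact: cf.
  rewrite in_itv /= => /andP[c1 c2] E; exists c.
    by rewrite (gtr0_norm h0) gtr0_norm; lra.
  by rewrite E; lra.
- by exists a; rewrite ?subrr ?normr0 // addr0 mulr0 subrr.
Qed.

(** Continuous partial derivatives give a total derivative: move first
    vertically and then horizontally, with the mean value theorem on each side. *)
Lemma gradc_incr u ux uy z (e : R) : gradc u ux uy -> 0 < e ->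
  \forall v \near (0 : R * R),
    `|u (v + z) - u z - (ux z * v.1 + uy z * v.2)| <= e * `|v|.
Proof.
case=> dx dy cx cy e0; have e20 : 0 < e / 2 by lra.
have /cvgrPdist_lt/(_ _ e20)/nbhs_ballP[d1 /= d10 H1] := cx z.
have /cvgrPdist_lt/(_ _ e20)/nbhs_ballP[d2 /= d20 H2] := cy z.
apply/nbhs_ballP; exists (Num.min d1 d2); first by rewrite /= lt_min d10 d20.
move=> [h k]; rewrite -ball_normE /= sub0r normrN lt_min => /andP[v1 v2].
have hv : `|h| <= `|(h, k)| by rewrite [leRHS]/Num.norm /= le_max lexx.
have kv : `|k| <= `|(h, k)| by rewrite [leRHS]/Num.norm /= le_max lexx orbT.
case: z H1 H2 => a b H1 H2 /=.
have [c1 c1h E1] := MVT_sym a h (fun x => dx x (k + b)).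
have [c2 c2h E2] := MVT_sym b k (fun y => dy a y).
have B1 : `|ux (a, b) - ux (c1, k + b)| < e / 2.
  apply: H1; split => /=; rewrite /ball /= distrC.
    by rewrite (le_lt_trans c1h) // (le_lt_trans hv).
  by rewrite addrK (le_lt_trans kv).
have B2 : `|uy (a, b) - uy (a, c2)| < e / 2.
  apply: H2; split => /=; rewrite /ball /= distrC.
    by rewrite subrr normr0.
  by rewrite (le_lt_trans c2h) // (le_lt_trans kv).
have -> : (h, k) + (a, b) = (a + h, b + k) by congr pair; rewrite addrC.
rewrite (_ : u _ - _ - _ = - ((ux (a, b) - ux (c1, k + b)) * h)
                      - (uy (a, b) - uy (a, c2)) * k); last first.
  rewrite [k + b]addrC in E1 *.
  rewrite (_ : u _ - u (a, b) = (u (a + h, b + k) - u (a, b + k))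
     + (u (a, b + k) - u (a, b))); last by ring.
  by rewrite E1 E2; ring.
rewrite (le_trans (ler_normB _ _)) // normrN !normrM.
rewrite [e in leRHS](splitr e) mulrDl lerD //.
  by apply: ler_pM => //; exact: ltW.
by apply: ler_pM => //; exact: ltW.
Qed.

Definition lin2 (a b : R) (v : R * R) : R := a * v.1 + b * v.2.

Fact lin2_linear a b : linear (lin2 a b).
Proof.
move=> k v w; rewrite /lin2 /= /GRing.scale /=; ring.
Qed.

HB.instance Definition _ a b :=
  GRing.isLinear.Build R (R * R)%type R _ (lin2 a b) (lin2_linear a b).

Lemma continuous_lin2 a b : continuous (lin2 a b).
Proof.
move=> z; apply: cvgD.
  by apply: cvgM; [exact: cvg_cst|exact: cvg_fst].
by apply: cvgM; [exact: cvg_cst|exact: cvg_snd].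
Qed.

Lemma gradc_differentiable u ux uy z : gradc u ux uy ->
  differentiable u z /\ 'd u z = lin2 (ux z) (uy z) :> (R * R -> R).
Proof.
move=> H.
pose V : normedModType R := (R * R)%type.
have H1 : (u : V -> R^o) \o @shift V z
    = cst (u z : R^o) + (lin2 (ux z) (uy z) : V -> R^o) +o_ (0 : V) id.
  apply/eqaddoP => _/posnumP[e]; near=> v.
  rewrite /= opprD addrA !fctE /=; near: v.
  exact: gradc_incr H _.
have H2 := diff_unique (@continuous_lin2 (ux z) (uy z)) H1.
split => //; apply/diff_locallyP; rewrite H2; split => //.
exact: continuous_lin2.
Unshelve. all: by end_near. Qed.

Lemma gradc_continuous u ux uy : gradc u ux uy -> continuous u.
Proof. by move=> H z; have [/differentiable_continuous] := gradc_differentiable z H. Qed.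


Lemma gradc_line u ux uy (a b c d s : R) : gradc u ux uy ->
  is_derive s (1 : R) (fun t : R => u (a + t * c, b + t * d))
    (ux (a + s * c, b + s * d) * c + uy (a + s * c, b + s * d) * d).
Proof.
move=> H.
have [D DE] := gradc_differentiable (a + s * c, b + s * d) H.
pose p (t : R) : R * R := (a + t * c, b + t * d).
have d1 : is_derive s (1 : R) (fun t : R => a + t * c) c.
  by apply: is_derive_eq; rewrite /GRing.scale /=; ring.
have d2 : is_derive s (1 : R) (fun t : R => b + t * d) d.
  by apply: is_derive_eq; rewrite /GRing.scale /=; ring.
have e1 : differentiable (fun t : R => a + t * c) s.
  by apply/derivable1_diffP; exact: ex_derive.
have e2 : differentiable (fun t : R => b + t * d) s.
  by apply/derivable1_diffP; exact: ex_derive.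
have e3 : differentiable p s by exact: differentiable_pair.
have e4 : differentiable (u \o p) s by exact: differentiable_comp.
apply: DeriveDef; first by apply/derivable1_diffP.
rewrite deriveE // diff_comp //= DE /lin2 diff_pair //= -!deriveE //.
by rewrite !derive_val.
Qed.

(** Schwarz's theorem. Both mixed derivatives, at nearby points, equal the
    double difference of [u] over a small square divided by its area. *)
Lemma gradc_mixed u ux uy uxx uxy uyx uyy :
  gradc u ux uy -> gradc ux uxx uxy -> gradc uy uyx uyy ->
  forall z, uxy z = uyx z.
Proof.
move=> [dx dy _ _] [_ dxy _ cxy] [dyx _ cyx _] [a b].
apply/eqP; rewrite -subr_eq0 -normr_le0; apply/ler_addgt0Pr => e e0; rewrite add0r.
have e20 : 0 < e / 2 by lra.
have /cvgrPdist_lt/(_ _ e20)/nbhs_ballP[d1 /= d10 H1] := cxy (a, b).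
have /cvgrPdist_lt/(_ _ e20)/nbhs_ballP[d2 /= d20 H2] := cyx (a, b).
pose h := Num.min d1 d2 / 2.
have m0 : 0 < Num.min d1 d2 by rewrite lt_min d10 d20.
have h0 : 0 < h by rewrite /h; lra.
have hd1 : h < d1 by rewrite (@lt_le_trans _ _ (Num.min d1 d2)) ?ge_min ?lexx // /h; lra.
have hd2 : h < d2 by rewrite (@lt_le_trans _ _ (Num.min d1 d2)) ?ge_min ?lexx ?orbT // /h; lra.
(* First in [x] then in [y] for one mixed derivative, in the other order for
   the other one. *)
have [c1 c1h E1] := @MVT_sym (fun x => u (x, b + h) - u (x, b))
   (fun x => ux (x, b + h) - ux (x, b)) a h (fun x => is_deriveB (dx x (b + h)) (dx x b)).
have [c2 c2h E2] := MVT_sym b h (fun y => dxy c1 y).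
have [c3 c3h E3] := @MVT_sym (fun y => u (a + h, y) - u (a, y))
   (fun y => uy (a + h, y) - uy (a, y)) b h (fun y => is_deriveB (dy (a + h) y) (dy a y)).
have [c4 c4h E4] := MVT_sym a h (fun x => dyx x c3).
have E : uxy (c1, c2) = uyx (c4, c3).
  have hn : h != 0 by rewrite gt_eqF.
  apply: (mulIf hn); apply: (mulIf hn).
  move: E1 E3 => /=; rewrite E2 E4 => <- <-; ring.
rewrite (_ : _ - _ = (uxy (a, b) - uxy (c1, c2)) - (uyx (a, b) - uyx (c4, c3))); last first.
  by rewrite E; ring.
rewrite (le_trans (ler_normB _ _)) // (splitr e) lerD // ltW //.
  by apply: H1; split => /=; rewrite /ball /= distrC;
     [rewrite (le_lt_trans c1h)|rewrite (le_lt_trans c2h)] => //; rewrite gtr0_norm.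
by apply: H2; split => /=; rewrite /ball /= distrC;
  [rewrite (le_lt_trans c4h)|rewrite (le_lt_trans c3h)] => //; rewrite gtr0_norm.
Qed.

Lemma contD2 u v : continuous u -> continuous v ->
  continuous (fun z => u z + v z).
Proof. by move=> h1 h2 z; exact: (@cvgD R R _ (nbhs z) _ u v _ _ (h1 z) (h2 z)). Qed.

Lemma contM2 u v : continuous u -> continuous v ->
  continuous (fun z => u z * v z).
Proof. by move=> h1 h2 z; exact: (@cvgM R _ (nbhs z) _ u v _ _ (h1 z) (h2 z)). Qed.

Lemma contN2 u : continuous u -> continuous (fun z => - u z).
Proof. by move=> h1 z; exact: (@cvgN R R _ (nbhs z) _ u _ (h1 z)). Qed.

Lemma gradcM u ux uy v vx vy : gradc u ux uy -> gradc v vx vy ->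
  gradc (fun z => u z * v z) (fun z => u z * vx z + v z * ux z)
        (fun z => u z * vy z + v z * uy z).
Proof.
move=> hu hv; have cu := gradc_continuous hu; have cv := gradc_continuous hv.
case: hu => ux' uy' cux cuy; case: hv => vx' vy' cvx cvy; split.
- by move=> x y; have du := ux' x y; have dv := vx' x y; apply: is_derive_eq.
- by move=> x y; have du := uy' x y; have dv := vy' x y; apply: is_derive_eq.
- exact (contD2 (contM2 cu cvx) (contM2 cv cux)).
- exact (contD2 (contM2 cu cvy) (contM2 cv cuy)).
Qed.

Lemma gradcD u ux uy v vx vy : gradc u ux uy -> gradc v vx vy ->
  gradc (fun z => u z + v z) (fun z => ux z + vx z) (fun z => uy z + vy z).
Proof.
move=> [ux' uy' cux cuy] [vx' vy' cvx cvy]; split.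
- move=> x y.
  exact (@is_deriveD R R R (fun t => u (t, y)) (fun t => v (t, y)) x 1 _ _
          (ux' x y) (vx' x y)).
- move=> x y.
  exact (@is_deriveD R R R (fun t => u (x, t)) (fun t => v (x, t)) y 1 _ _
          (uy' x y) (vy' x y)).
- exact (contD2 cux cvx).
- exact (contD2 cuy cvy).
Qed.

Lemma gradc_eq u ux uy ux' uy' : gradc u ux uy -> ux =1 ux' -> uy =1 uy' ->
  gradc u ux' uy'.
Proof. by move=> H /funext E1 /funext E2; rewrite -E1 -E2. Qed.

Lemma real_harmonicE u : real_harmonic u -> exists ux uy uxx uxy uyy,
  [/\ gradc u ux uy, gradc ux uxx uxy, gradc uy uxy uyy &
      forall z, uyy z = - uxx z].
Proof.
have C1P v : C1 v -> gradc v (partial_x v) (partial_y v).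
  by case=> dx dy cx cy; split; [exact (derivable_pdx dx)|exact (derivable_pdy dy)|exact cx|exact cy].
case=> /C1P; move: (partial_x u) (partial_y u) => ux uy Hu.
case=> dx dy cx cy Cy Hh.
move/C1P: Cy; have /C1P : C1 ux by exact (And4 dx dy cx cy).
move: {dx dy cx cy} Hh.
move: (partial_x ux) (partial_y ux) (partial_x uy) (partial_y uy).
move=> uxx uxy uyx uyy Hh Hx Hy.
exists ux, uy, uxx, uxy, uyy; split; [exact Hu|exact Hx| |].
  apply: (gradc_eq Hy) => // z; exact: esym (gradc_mixed Hu Hx Hy z).
by move=> z; apply/eqP; rewrite -addr_eq0 addrC Hh.
Qed.

End calculus.

(** * Integrals of compactly supported functions *)

Section plane_integral.
Context {R : realType}.
Implicit Types (u v : R * R -> R) (z w : R * R).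

(** The plane carries the product of the Borel sigma-algebras of the lines. An
    open set is the countable union of the rational squares it contains. *)
Lemma open_plane_measurable (U : set (R * R)) : open U ->
  measurable (U : set (plane R)).
Proof.
move=> oU.
pose B (i : rat * rat * nat) : set (plane R) :=
  ball (ratr i.1.1 : R) (i.2.+1%:R^-1) `*` ball (ratr i.1.2 : R) (i.2.+1%:R^-1).
pose F i : set (plane R) := if `[< B i `<=` U >] then B i else set0.
have -> : U = \bigcup_i F i.
  apply/seteqP; split => [[x y] Uxy|z [i _]]; last first.
    by rewrite /F; case: ifPn => // /asboolP BU; exact: BU.
  have /nbhs_ballP[e /= e0 H] : nbhs (x, y) U by exact: open_nbhs_nbhs.
  have [n ne] : exists n : nat, n.+1%:R^-1 < e / 2 :> R.
    have [n _ /(_ n (leqnn n))] := near_infty_natSinv_lt (PosNum (divr_gt0 e0 (@ltr0n R 2))).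
    by exists n.
  have [d dE] : exists d : R, d = n.+1%:R^-1 by eexists.
  have n0 : 0 < d by rewrite dE invr_gt0 ltr0n.
  rewrite -dE in ne.
  have xd : x - d < x + d by lra.
  have yd : y - d < y + d by lra.
  (* A rational square containing the point, small enough to stay inside the
     ball of radius [e]. *)
have [p] := rat_in_itvoo xd; rewrite in_itv /= => /andP[p1 p2].
  have [q] := rat_in_itvoo yd; rewrite in_itv /= => /andP[q1 q2].
  exists ((p, q), n) => //; rewrite /F /B /= -dE; case: ifPn => [_|/asboolP []].
    by split; rewrite /ball /= ltr_norml; lra.
  move=> [s t] [/= h1 h2]; apply: H; split => /=.
  - by move: h1; rewrite /ball /= !ltr_norml; lra.
  - by move: h2; rewrite /ball /= !ltr_norml; lra.
apply: countable_bigcupT_measurable => // i; rewrite /F; case: ifP => // _.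
by apply: measurableX; exact: measurable_ball.
Qed.

Lemma continuous_plane_measurable (f : R * R -> R) : continuous f ->
  measurable_fun (setT : set (plane R)) (f : plane R -> measurableTypeR R).
Proof.
move=> /continuousP cf; apply: (measurability _ (RGenOpens.measurableE R)).
move=> _ [_ [a [b ->] <-]]; rewrite setTI; apply: open_plane_measurable.
exact/cf/interval_open.
Qed.

(** Supports are confined to squares rather than discs so that every horizontal
    and vertical slice is confined to an interval. *)
Definition supp_in (c : R * R) (rho : R) (f : R * R -> R) :=
  forall z, (rho <= `|z.1 - c.1|) || (rho <= `|z.2 - c.2|) -> f z = 0.

Lemma areaX (A B : set (measurableTypeR R)) : measurable A -> measurable B ->
  area R (A `*` B) = (lebesgue_measure A * lebesgue_measure B)%E.
Proof. by move=> mA mB; exact: product_measure1E. Qed.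

Lemma supp_integrable c rho (f : R * R -> R) : continuous f -> supp_in c rho f ->
  (area R).-integrable setT (EFin \o f).
Proof.
move=> cf sf.
pose I1 : set R := `[c.1 - rho, c.1 + rho]%classic.
pose I2 : set R := `[c.2 - rho, c.2 + rho]%classic.
have mI : measurable (I1 `*` I2 : set (plane R)) by apply: measurableX; exact: measurable_itv.
have -> : EFin \o f = (EFin \o f) \_ (I1 `*` I2 : set (plane R)).
  apply/funext => z; rewrite patchE; case: ifPn => // /negP zI; congr EFin.
  apply: sf; apply/negPn/negP; rewrite negb_or -!ltNge => /andP[z1 z2].
  apply: zI; rewrite inE /I1 /I2; split; rewrite /= in_itv /=.
    by move: z1; rewrite ltr_norml; lra.
  by move: z2; rewrite ltr_norml; lra.
apply: (@integrable_mkcond _ (plane R) R (area R) _ (EFin \o f) mI).1.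
apply: measurable_bounded_integrable => //.
- rewrite areaX ?/I1 ?/I2 //= !lebesgue_measure_itv /=.
  by do 2 case: ifP => _; rewrite ?mule0 ?mul0e // -!EFinD -EFinM ltry.
- exact: measurable_funS (continuous_plane_measurable cf).
- have cI : compact (I1 `*` I2) by apply: compact_setX; exact: segment_compact.
  have cf' : {within I1 `*` I2, continuous f} by exact: continuous_subspaceT.
  have /compact_bounded[M [_ mrt]] := continuous_compact cf' cI.
  by exists M; split; rewrite ?num_real // => ? ? ? ?; exact: mrt.
Qed.

Lemma cont_slice1 (f : R * R -> R) (y : R) : continuous f ->
  continuous (fun x : R => f (x, y)).
Proof.
move=> cf x; apply: (@cvg_comp _ _ _ (fun x : R => (x, y)) f); last exact: cf.
exact: (cvg_pair (@cvg_id _ (nbhs x)) (@cvg_cst _ y R (nbhs x) _)).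
Qed.

Lemma cont_slice2 (f : R * R -> R) (x : R) : continuous f ->
  continuous (fun y : R => f (x, y)).
Proof.
move=> cf y; apply: (@cvg_comp _ _ _ (fun y : R => (x, y)) f); last exact: cf.
exact: (cvg_pair (@cvg_cst _ x R (nbhs y) _) (@cvg_id _ (nbhs y))).
Qed.

Lemma integral_derive_supp (F f : R -> R) (c rho : R) : 0 < rho ->
  (forall x, is_derive x (1 : R) F (f x)) -> continuous f ->
  (forall x, rho <= `|x - c| -> F x = 0) ->
  (forall x, rho <= `|x - c| -> f x = 0) ->
  (\int[lebesgue_measure]_x (f x)%:E = 0)%E.
Proof.
move=> r0 dF cf F0 f0.
have -> : (\int[lebesgue_measure]_x (f x)%:E
    = \int[lebesgue_measure]_(x in `[(c - rho)%R, (c + rho)%R]) (f x)%:E)%E.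
  rewrite [RHS]integral_mkcond; apply: eq_integral => x _; rewrite patchE.
  case: ifPn => // /negP h; rewrite f0 // leNgt; apply/negP => xc; apply: h.
  by rewrite inE /= in_itv /=; move: xc; rewrite ltr_norml; lra.
have cF x : F t @[t --> x] --> F x.
  by apply: differentiable_continuous; apply/derivable1_diffP; exact: ex_derive.
rewrite (@continuous_FTC2 _ f F (c - rho) (c + rho)).
- have -> : F (c + rho) = 0 by apply: F0; rewrite addrAC subrr add0r ler_norm.
  have -> : F (c - rho) = 0.
    by apply: F0; rewrite addrAC subrr add0r normrN ler_norm.
  by rewrite subee.
- lra.
- exact: continuous_subspaceT.
- split.
  + by move=> x _; exact: ex_derive.
  + by apply: cvg_at_right_filter; exact: cF.
  + by apply: cvg_at_left_filter; exact: cF.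
- by move=> x _; rewrite derive1E; apply: derive_val.
Qed.

(** The divergence theorem without boundary term: by Fubini, it reduces to the
    fundamental theorem of calculus on each line. *)
Lemma Rintegral_pdx_supp c rho F f : 0 < rho -> pdx F f -> continuous f ->
  supp_in c rho F -> supp_in c rho f -> \int[area R]_z f z = 0.
Proof.
move=> r0 dF cf sF sf.
rewrite /Rintegral -[LHS]/(fine (\int[area R]_z (f z)%:E)%E).
have := integral21_prod_meas1 (supp_integrable cf sf) => /= <-.
rewrite integral0_eq // => y _.
apply: (@integral_derive_supp (fun x => F (x, y)) (fun x => f (x, y)) c.1 rho) => //.
- exact: cont_slice1.
- by move=> x h; apply: sF; rewrite /= h.
- by move=> x h; apply: sf; rewrite /= h.
Qed.

Lemma Rintegral_pdy_supp c rho F f : 0 < rho -> pdy F f -> continuous f ->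
  supp_in c rho F -> supp_in c rho f -> \int[area R]_z f z = 0.
Proof.
move=> r0 dF cf sF sf.
rewrite /Rintegral -[LHS]/(fine (\int[area R]_z (f z)%:E)%E).
have := integral12_prod_meas1 (supp_integrable cf sf) => /= <-.
rewrite integral0_eq // => x _.
apply: (@integral_derive_supp (fun y => F (x, y)) (fun y => f (x, y)) c.2 rho) => //.
- exact: cont_slice2.
- by move=> y h; apply: sF; rewrite /= h orbT.
- by move=> y h; apply: sf; rewrite /= h orbT.
Qed.

End plane_integral.

(** * A radial cutoff and the exponential kernels *)

Section cutoff_and_expcos.
Context {R : realType}.
Implicit Types (u v : R * R -> R) (z w : R * R).

(** A criterion for derivability that does not require splitting a
    neighbourhood at a point where the formula for [f] changes. *)
Lemma is_derive_quadratic (f : R -> R) (s l : R) :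
  (forall t, `|f t - f s - l * (t - s)| <= (t - s) ^+ 2) -> is_derive s (1 : R) f l.
Proof.
move=> H.
have L : h^-1 *: (f (h *: 1 + s) - f s) @[h --> 0^'] --> l.
  apply/cvgrPdist_lt => e e0; near=> h.
  have h0 : h != 0 by near: h; exact: nbhs_dnbhs_neq.
  have he : `|h| < e by near: h; exact: dnbhs0_lt.
  have := H (h *: 1 + s); rewrite addrK /GRing.scale /= mulr1 => Hh.
  rewrite -(ltr_pM2l (_ : 0 < `|h|)) ?normr_gt0 // -normrM.
  rewrite mulrBr mulrA mulfV // mul1r distrC [h * l]mulrC.
  rewrite (le_lt_trans Hh) // -(real_normK (num_real h)) expr2.
  by rewrite ltr_pM2l // normr_gt0.
apply: DeriveDef; first by apply/cvg_ex; exists l.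
exact: cvg_lim L.
Unshelve. all: by end_near. Qed.

Lemma is_derive_pospart2 (s : R) :
  is_derive s (1 : R) (fun t => (Num.max 0 t) ^+ 2) (2 * Num.max 0 s).
Proof.
apply: is_derive_quadratic => t; rewrite /= ler_norml !expr2.
have sq0 : 0 <= (t - s) * (t - s) by rewrite -expr2 sqr_ge0.
have t2 : 0 <= t * t by rewrite -expr2 sqr_ge0.
have s2 : 0 <= s * s by rewrite -expr2 sqr_ge0.
have E : (t - s) * (t - s) = t * t - 2 * (s * t) + s * s by ring.
have E' : 2 * s * (t - s) = 2 * (s * t) - 2 * (s * s) by ring.
case: (leP 0 t) => t0; case: (leP 0 s) => s0;
  rewrite ?mulr0 ?mul0r ?subr0 ?sub0r ?E'.
- by apply/andP; split; lra.
- have ts : s * t <= 0 by rewrite mulr_le0_ge0 // ltW.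
  by apply/andP; split; lra.
- have ts : s * t <= 0 by rewrite mulr_ge0_le0 // ltW.
  by apply/andP; split; lra.
- by apply/andP; split; lra.
Qed.

Definition sqdist (z w : R * R) : R := (z.1 - w.1) ^+ 2 + (z.2 - w.2) ^+ 2.

Definition pospart (c : R * R) (rho : R) (z : R * R) : R :=
  Num.max 0 (rho ^+ 2 - sqdist z c).

(** The square of the positive part is the cheapest radial cutoff of class C1. *)
Definition cutoff c rho z : R := pospart c rho z ^+ 2.

Lemma pospart_ge0 c rho z : 0 <= pospart c rho z.
Proof. by rewrite /pospart le_max lexx. Qed.

Lemma sqdist_ge0 z w : 0 <= sqdist z w.
Proof. by rewrite addr_ge0 // sqr_ge0. Qed.

Lemma pospart_le c rho z : pospart c rho z <= rho ^+ 2.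
Proof. by rewrite /pospart ge_max sqr_ge0 /= gerBl sqdist_ge0. Qed.

Lemma pospart_out c rho z : rho ^+ 2 <= sqdist z c -> pospart c rho z = 0.
Proof. by move=> h; rewrite /pospart; apply/max_idPl; rewrite subr_le0. Qed.

Lemma pospart_supp c rho : 0 < rho -> supp_in c rho (pospart c rho).
Proof.
move=> r0 z h; apply: pospart_out; rewrite /sqdist.
have [h1|h1] := orP h.
  have : rho ^+ 2 <= `|z.1 - c.1| ^+ 2 by rewrite ler_sqr ?nnegrE // ltW.
  by rewrite real_normK ?num_real // => H; rewrite (le_trans H) // lerDl sqr_ge0.
have : rho ^+ 2 <= `|z.2 - c.2| ^+ 2 by rewrite ler_sqr ?nnegrE // ltW.
by rewrite real_normK ?num_real // => H; rewrite (le_trans H) // lerDr sqr_ge0.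
Qed.

Lemma cont_fst : continuous (fun z : R * R => z.1).
Proof. by move=> z; exact: cvg_fst. Qed.

Lemma cont_snd : continuous (fun z : R * R => z.2).
Proof. by move=> z; exact: cvg_snd. Qed.

Lemma cont_cst (k : R) : continuous (fun _ : R * R => k).
Proof. by move=> z; exact: cvg_cst. Qed.

Lemma cont_comp (f : R -> R) u : continuous f -> continuous u ->
  continuous (fun z => f (u z)).
Proof. by move=> cf cu z; apply: continuous_comp; [exact: cu|exact: cf]. Qed.

Lemma cont_sqdist c : continuous (fun z => sqdist z c).
Proof.
have c1 := contD2 cont_fst (@cont_cst (- c.1)).
have c2 := contD2 cont_snd (@cont_cst (- c.2)).
exact (contD2 (contM2 c1 c1) (contM2 c2 c2)).
Qed.

Lemma cont_pospart c rho : continuous (pospart c rho).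
Proof.
have c1 := contD2 (@cont_cst (rho ^+ 2)) (contN2 (@cont_sqdist c)).
move=> z.
exact (@continuous_max R (R * R)%type (fun _ => 0) _ z (@cont_cst 0 z) (c1 z)).
Qed.

Lemma comp_derive (f g : R -> R) (x df dg : R) :
  is_derive (g x) (1 : R) f df -> is_derive x (1 : R) g dg ->
  is_derive x (1 : R) (fun t => f (g t)) (df * dg).
Proof. by move=> hf hg; exact: (@is_derive1_comp R f g x df dg hf hg). Qed.

Lemma eq_derive (f : R -> R) (x a b : R) : is_derive x (1 : R) f a -> a = b ->
  is_derive x (1 : R) f b.
Proof. by move=> h <-. Qed.

Lemma gradc_cutoff c rho : gradc (cutoff c rho)
  (fun z => - 4 * (z.1 - c.1) * pospart c rho z)
  (fun z => - 4 * (z.2 - c.2) * pospart c rho z).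
Proof.
split.
- move=> x y.
  have d1 : is_derive x (1 : R) (fun t : R => rho ^+ 2 - sqdist (t, y) c) (- 2 * (x - c.1)).
    by rewrite /sqdist /=; apply: is_derive_eq; rewrite /GRing.scale /=; ring.
  have d2 := is_derive_pospart2 (rho ^+ 2 - sqdist (x, y) c).
  apply: (eq_derive (@comp_derive (fun t => Num.max 0 t ^+ 2)
    (fun t => rho ^+ 2 - sqdist (t, y) c) x _ _ d2 d1)).
  rewrite /pospart /=; ring.
- move=> x y.
  have d1 : is_derive y (1 : R) (fun t : R => rho ^+ 2 - sqdist (x, t) c) (- 2 * (y - c.2)).
    by rewrite /sqdist /=; apply: is_derive_eq; rewrite /GRing.scale /=; ring.
  have d2 := is_derive_pospart2 (rho ^+ 2 - sqdist (x, y) c).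
  apply: (eq_derive (@comp_derive (fun t => Num.max 0 t ^+ 2)
    (fun t => rho ^+ 2 - sqdist (x, t) c) y _ _ d2 d1)).
  rewrite /pospart /=; ring.
- exact (contM2 (contM2 (@cont_cst _) (contD2 cont_fst (@cont_cst (- c.1)))) (@cont_pospart c rho)).
- exact (contM2 (contM2 (@cont_cst _) (contD2 cont_snd (@cont_cst (- c.2)))) (@cont_pospart c rho)).
Qed.

Definition affine (p q k : R) (z : R * R) : R := p * z.1 + q * z.2 + k.
(** [expcos] with linear parts [(p, q)] and [(s, t)] is
    [exp A * Re ((c1 - i c2) exp (i B))] for affine [A] and [B]. For fixed [A]
    and [B] the family is closed under differentiation, and it contains the real
    and imaginary parts of exponentials of affine holomorphic functions. *)
Definition expcos (p q k s t l c1 c2 : R) (z : R * R) : R :=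
  expR (affine p q k z) *
    (c1 * cos (affine s t l z) + c2 * sin (affine s t l z)).

Lemma cont_affine p q k : continuous (affine p q k).
Proof.
exact (contD2 (contD2 (contM2 (@cont_cst p) cont_fst) (contM2 (@cont_cst q) cont_snd)) (@cont_cst k)).
Qed.

Lemma cont_expcos p q k s t l c1 c2 : continuous (expcos p q k s t l c1 c2).
Proof.
have ca := cont_affine (p:=s) (q:=t) (k:=l).
exact (contM2 (cont_comp (@continuous_expR R) (@cont_affine p q k))
  (contD2 (contM2 (@cont_cst c1) (cont_comp (@continuous_cos R) ca))
          (contM2 (@cont_cst c2) (cont_comp (@continuous_sin R) ca)))).
Qed.

Lemma gradc_expcos p q k s t l c1 c2 : gradc (expcos p q k s t l c1 c2)
  (expcos p q k s t l (p * c1 + s * c2) (p * c2 - s * c1))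
  (expcos p q k s t l (q * c1 + t * c2) (q * c2 - t * c1)).
Proof.
split.
- move=> x y.
  have dA : is_derive x (1 : R) (fun v : R => affine p q k (v, y)) p.
    by rewrite /affine /=; apply: is_derive_eq; rewrite /GRing.scale /=; ring.
  have dB : is_derive x (1 : R) (fun v : R => affine s t l (v, y)) s.
    by rewrite /affine /=; apply: is_derive_eq; rewrite /GRing.scale /=; ring.
  have d1 := @comp_derive expR (fun v : R => affine p q k (v, y)) x _ _
    (is_derive_expR _) dA.
  have d2 := @comp_derive cos (fun v : R => affine s t l (v, y)) x _ _
    (is_derive_cos _) dB.
  have d3 := @comp_derive sin (fun v : R => affine s t l (v, y)) x _ _
    (is_derive_sin _) dB.
  rewrite /expcos.
  move: d1 d2 d3.
  set f1 := (fun v : R => expR _); set f2 := (fun v : R => cos _); set f3 := (fun v : R => sin _).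
  move=> d1 d2 d3.
  refine (@is_derive_eq R R R (fun v : R => f1 v * (c1 * f2 v + c2 * f3 v)) x 1 _ _ _ _).
  rewrite /f1 /f2 /f3 /GRing.scale /=; ring.
- move=> x y.
  have dA : is_derive y (1 : R) (fun v : R => affine p q k (x, v)) q.
    by rewrite /affine /=; apply: is_derive_eq; rewrite /GRing.scale /=; ring.
  have dB : is_derive y (1 : R) (fun v : R => affine s t l (x, v)) t.
    by rewrite /affine /=; apply: is_derive_eq; rewrite /GRing.scale /=; ring.
  have d1 := @comp_derive expR (fun v : R => affine p q k (x, v)) y _ _
    (is_derive_expR _) dA.
  have d2 := @comp_derive cos (fun v : R => affine s t l (x, v)) y _ _
    (is_derive_cos _) dB.
  have d3 := @comp_derive sin (fun v : R => affine s t l (x, v)) y _ _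
    (is_derive_sin _) dB.
  rewrite /expcos.
  move: d1 d2 d3.
  set f1 := (fun v : R => expR _); set f2 := (fun v : R => cos _); set f3 := (fun v : R => sin _).
  move=> d1 d2 d3.
  refine (@is_derive_eq R R R (fun v : R => f1 v * (c1 * f2 v + c2 * f3 v)) y 1 _ _ _ _).
  rewrite /f1 /f2 /f3 /GRing.scale /=; ring.
- exact: cont_expcos.
- exact: cont_expcos.
Qed.

End cutoff_and_expcos.

(** * The mean value property for Cauchy-Riemann pairs *)

Section dilations.
Context {R : realType}.
Implicit Types (u v : R * R -> R) (z w : R * R).

Definition dil (c : R * R) (t : R) (z : R * R) : R * R :=
  (c.1 + t * (z.1 - c.1), c.2 + t * (z.2 - c.2)).

Lemma dil1 c z : dil c 1 z = z.
Proof. by case: z => x y; rewrite /dil /= !mul1r; congr pair; ring. Qed.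

Lemma dil0 c z : dil c 0 z = c.
Proof. by case: c => x y; rewrite /dil /= !mul0r !addr0. Qed.

Lemma cont_dil (h : R * R -> R) c t : continuous h ->
  continuous (fun z => h (dil c t z)).
Proof.
move=> ch.
have e1 := contD2 (@cont_cst R c.1) (contM2 (@cont_cst R t) (contD2 (@cont_fst R) (@cont_cst R (- c.1)))).
have e2 := contD2 (@cont_cst R c.2) (contM2 (@cont_cst R t) (contD2 (@cont_snd R) (@cont_cst R (- c.2)))).
move=> z; apply: (@cvg_comp _ _ _ (dil c t) h); last exact: ch.
exact: (cvg_pair (e1 z) (e2 z)).
Qed.

Lemma gradc_dil h hx hy c t : gradc h hx hy ->
  gradc (fun z => h (dil c t z)) (fun z => t * hx (dil c t z))
        (fun z => t * hy (dil c t z)).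
Proof.
case=> dx dy cx cy; split.
- move=> x y.
  have d1 : is_derive x (1 : R) (fun a : R => c.1 + t * (a - c.1)) t.
    by apply: is_derive_eq; rewrite /GRing.scale /=; ring.
  have d2 := dx (c.1 + t * (x - c.1)) (c.2 + t * (y - c.2)).
  apply: (eq_derive (@comp_derive R (fun a => h (a, c.2 + t * (y - c.2)))
    (fun a => c.1 + t * (a - c.1)) x _ _ d2 d1)).
  by rewrite mulrC.
- move=> x y.
  have d1 : is_derive y (1 : R) (fun a : R => c.2 + t * (a - c.2)) t.
    by apply: is_derive_eq; rewrite /GRing.scale /=; ring.
  have d2 := dy (c.1 + t * (x - c.1)) (c.2 + t * (y - c.2)).
  apply: (eq_derive (@comp_derive R (fun a => h (c.1 + t * (x - c.1), a))
    (fun a => c.2 + t * (a - c.2)) y _ _ d2 d1)).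
  by rewrite mulrC.
- exact (contM2 (@cont_cst R t) (cont_dil cx)).
- exact (contM2 (@cont_cst R t) (cont_dil cy)).
Qed.

Lemma cont_bounded_box (h : R * R -> R) c (r : R) : continuous h ->
  exists2 M, 0 <= M & forall z, `|z.1 - c.1| <= r -> `|z.2 - c.2| <= r ->
    `|h z| <= M.
Proof.
move=> ch.
pose I1 : set R := `[c.1 - r, c.1 + r]%classic.
pose I2 : set R := `[c.2 - r, c.2 + r]%classic.
have cI : compact (I1 `*` I2) by apply: compact_setX; exact: segment_compact.
have ch' : {within I1 `*` I2, continuous h} by exact: continuous_subspaceT.
have /compact_bounded[M [_ mrt]] := continuous_compact ch' cI.
exists (Num.max 0 (M + 1)); first by rewrite le_max lexx.
move=> z z1 z2; rewrite le_max; apply/orP; right; apply: (mrt (M + 1)).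
  by rewrite ltrDl.
exists z => //; split; rewrite /I1 /I2 /= in_itv /=.
  by move: z1; rewrite ler_norml; lra.
by move: z2; rewrite ler_norml; lra.
Qed.

Lemma cutoff_supp (c : R * R) (rho : R) : 0 < rho -> supp_in c rho (cutoff c rho).
Proof. by move=> r0 z h; rewrite /cutoff pospart_supp // expr2 mul0r. Qed.

Lemma supp_inM (c : R * R) (rho : R) (f g : R * R -> R) : supp_in c rho g ->
  supp_in c rho (fun z => f z * g z).
Proof. by move=> sg z h; rewrite sg // mulr0. Qed.

Lemma cont_cutoff (c : R * R) (rho : R) : continuous (@cutoff R c rho).
Proof. exact (gradc_continuous (gradc_cutoff c rho)). Qed.

Lemma cutoff_ge0 (c : R * R) (rho : R) z : 0 <= @cutoff R c rho z.
Proof. by rewrite /cutoff sqr_ge0. Qed.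

End dilations.

Section mean_value_property.
Context {R : realType}.
Implicit Types (u v : R * R -> R) (z w : R * R).

(** The integrand is the derivative of [h] in the angular direction times a
    radial function, and the field [(- y, x)] is divergence free. *)
Lemma rotation_integral0 (h hx hy : R * R -> R) (c : R * R) (rho : R) :
  gradc h hx hy -> 0 < rho ->
  \int[area R]_z ((hy z * (z.1 - c.1) - hx z * (z.2 - c.2)) * cutoff c rho z) = 0.
Proof.
move=> gh r0; have ch := gradc_continuous gh.
have gc := gradc_cutoff c rho.
have [hx' hy' chx chy] := gh; have [kx ky ckx cky] := gc.
have c1 := contD2 (@cont_fst R) (@cont_cst R (- c.1)).
have c2 := contD2 (@cont_snd R) (@cont_cst R (- c.2)).
pose Fx z := - (h z * cutoff c rho z * (z.2 - c.2)).
pose Fy z := h z * cutoff c rho z * (z.1 - c.1).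
have [px py _ _] := gradcM gh gc.
pose fx z := - ((h z * (- 4 * (z.1 - c.1) * pospart c rho z) + cutoff c rho z * hx z) * (z.2 - c.2)).
pose fy z := (h z * (- 4 * (z.2 - c.2) * pospart c rho z) + cutoff c rho z * hy z) * (z.1 - c.1).
have dFx : pdx Fx fx.
  move=> x y; have d := px x y.
  refine (@is_derive_eq R R R (fun v : R => - (h (v, y) * cutoff c rho (v, y) * (y - c.2))) x 1 _ _ _ _).
  rewrite /fx /GRing.scale /=; ring.
have dFy : pdy Fy fy.
  move=> x y; have d := py x y.
  refine (@is_derive_eq R R R (fun v : R => h (x, v) * cutoff c rho (x, v) * (x - c.1)) y 1 _ _ _ _).
  rewrite /fy /GRing.scale /=; ring.
have cfx : continuous fx.
  exact (contN2 (contM2 (contD2 (contM2 ch ckx) (contM2 (@cont_cutoff R c rho) chx)) c2)).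
have cfy : continuous fy.
  exact (contM2 (contD2 (contM2 ch cky) (contM2 (@cont_cutoff R c rho) chy)) c1).
have s0 := @pospart_supp R c rho r0; have s1 := @cutoff_supp R c rho r0.
have sFx : supp_in c rho Fx by move=> z zo; rewrite /Fx s1 // mulr0 mul0r oppr0.
have sFy : supp_in c rho Fy by move=> z zo; rewrite /Fy s1 // mulr0 mul0r.
have sfx : supp_in c rho fx.
  by move=> z zo; rewrite /fx s1 // s0 // mul0r !mulr0 addr0 mul0r oppr0.
have sfy : supp_in c rho fy.
  by move=> z zo; rewrite /fy s1 // s0 // mul0r !mulr0 addr0 mul0r.
have E1 := Rintegral_pdx_supp r0 dFx cfx sFx sfx.
have E2 := Rintegral_pdy_supp r0 dFy cfy sFy sfy.
have := RintegralD measurableT (supp_integrable cfx sfx) (supp_integrable cfy sfy).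
rewrite E1 E2 addr0 => <-; apply: eq_Rintegral => z _.
rewrite /fx /fy; ring.
Qed.

(** Dilating towards [c], the average of [h1] over the dilated cutoff has, by
    the Cauchy-Riemann equations, the angular derivative of the conjugate
    function [h2] as its radial derivative. This integrates to zero, so the
    average does not depend on the dilation factor; factor 0 gives [h1 c]. *)
Theorem mean_value_CR (h1 h1x h1y h2 h2x h2y : R * R -> R) (c : R * R) (rho : R) :
  gradc h1 h1x h1y -> gradc h2 h2x h2y ->
  (forall z, h1x z = h2y z) -> (forall z, h1y z = - h2x z) -> 0 < rho ->
  \int[area R]_z (h1 z * cutoff c rho z)
  = h1 c * \int[area R]_z cutoff c rho z.
Proof.
move=> g1 g2 CR1 CR2 r0.
have [dx1 dy1 cx1 cy1] := g1; have c1 := gradc_continuous g1.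
have ck := @cont_cutoff R c rho; have sk := @cutoff_supp R c rho r0.
pose f (t : R) (z : plane R) : R := h1 (dil c t z) * cutoff c rho z.
pose f' (t : R) (z : plane R) : R := (h1x (dil c t z) * (z.1 - c.1)
   + h1y (dil c t z) * (z.2 - c.2)) * cutoff c rho z.
have df t z : is_derive t (1 : R) (f^~ z) (f' t z).
  have d := gradc_line c.1 c.2 (z.1 - c.1) (z.2 - c.2) t g1.
  refine (@is_derive_eq R R R (fun v : R => h1 (c.1 + v * (z.1 - c.1), c.2 + v * (z.2 - c.2)) * cutoff c rho z) t 1 _ _ _ _).
  rewrite /f' /dil /GRing.scale /=; ring.
have intf t : (area R).-integrable setT (EFin \o f t).
  apply: (@supp_integrable R c rho); first exact (contM2 (cont_dil c1) ck).
  exact: supp_inM.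
have [M1 M10 B1] := cont_bounded_box c (2 * rho) cx1.
have [M2 M20 B2] := cont_bounded_box c (2 * rho) cy1.
pose G (z : plane R) := (M1 * rho + M2 * rho) * cutoff c rho z.
have G0 z : 0 <= G z.
  by rewrite /G mulr_ge0 ?cutoff_ge0 // addr_ge0 // mulr_ge0 // ltW.
have intG : (area R).-integrable setT (EFin \o G).
  apply: (@supp_integrable R c rho); first exact (contM2 (@cont_cst R _) ck).
  exact: supp_inM.
have d1 t z : partial1of2 f t z = f' t z.
  by rewrite partial1of2E; have := df t z => d; rewrite derive_val.
have Gub (t : R) z : t \in `](-1 : R), 2[ -> setT z -> `|partial1of2 f t z| <= G z.
  rewrite in_itv /= => /andP[t1 t2] _; rewrite d1 /f' /G.
  have [zo|] := boolP ((rho <= `|z.1 - c.1|) || (rho <= `|z.2 - c.2|)).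
    by rewrite sk // !mulr0 normr0.
  rewrite negb_or -!ltNge => /andP[z1 z2].
  have t2' : `|t| <= 2 by rewrite ler_norml; lra.
  have D1 : `|(dil c t z).1 - c.1| <= 2 * rho.
    by rewrite /dil /= addrAC subrr add0r normrM ler_pM // ltW.
  have D2 : `|(dil c t z).2 - c.2| <= 2 * rho.
    by rewrite /dil /= addrAC subrr add0r normrM ler_pM // ltW.
  rewrite normrM [X in _ * X <= _]ger0_norm ?cutoff_ge0 //.
  apply: ler_wpM2r; first exact: cutoff_ge0.
  rewrite (le_trans (ler_normD _ _)) // !normrM lerD // ler_pM //.
  - exact: B1.
  - exact: ltW.
  - exact: B2.
  - exact: ltW.
(* [phi t] is the average of [h1] dilated by [t] towards [c]. *)
pose phi t := \int[area R]_z f t z.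
have dphi (t : R) : t \in `](-1 : R), 2[ -> is_derive t (1 : R) phi (\int[area R]_z f' t z).
  move=> tI.
  have D := @derivable_under_integral R _ (plane R) (area R) f setT measurableT t (-1) 2
    tI (fun x _ => intf x) (fun x y _ _ => @ex_derive _ _ _ _ _ _ _ (df x y)) G G0 intG Gub.
  have E := @differentiation_under_integral R _ (plane R) (area R) f setT measurableT t (-1) 2
    tI (fun x _ => intf x) (fun x y _ _ => @ex_derive _ _ _ _ _ _ _ (df x y)) G G0 intG Gub.
  apply: DeriveDef; first exact: D.
  rewrite -derive1E [LHS]E; apply: eq_Rintegral => z _; exact: d1.
(* The rotation integral carries a factor [t], which is cancelled; at 0 the
   continuity of [phi] suffices for the mean value theorem. *)
have phi'0 (t : R) : 0 < t -> \int[area R]_z f' t z = 0.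
  move=> t0.
  have gd := gradc_dil c t g2.
  have := rotation_integral0 c gd r0.
  have cont' : continuous (f' t).
    have e1 := contD2 (@cont_fst R) (@cont_cst R (- c.1)).
    have e2 := contD2 (@cont_snd R) (@cont_cst R (- c.2)).
    exact (contM2 (contD2 (contM2 (cont_dil cx1) e1) (contM2 (cont_dil cy1) e2)) ck).
  have int' : (area R).-integrable setT (EFin \o f' t).
    by apply: (@supp_integrable R c rho (f' t) cont'); exact: supp_inM.
  have -> : \int[area R]_z ((t * h2y (dil c t z) * (z.1 - c.1)
      - t * h2x (dil c t z) * (z.2 - c.2)) * cutoff c rho z) =
      \int[area R]_z (t * f' t z).
    apply: eq_Rintegral => z _; rewrite /f' CR1 CR2; ring.
  rewrite RintegralZl // => /eqP; rewrite mulf_eq0 (gt_eqF t0) /= => /eqP.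
  exact.
have phic : {within `[0, 1], continuous phi}.
  apply: derivable_within_continuous => t; rewrite in_itv /= => /andP[t0 t1].
  have tI : t \in `](-1 : R), 2[ by rewrite in_itv /=; lra.
  have d := dphi t tI; exact: ex_derive.
pose dp (t : R) : R := \int[area R]_z f' t z.
have dphi' (t : R) : t \in `](0 : R), 1[ -> is_derive t (1 : R) phi (dp t).
  rewrite in_itv /= => /andP[t0 t1]; apply: dphi; rewrite in_itv /=; lra.
have [s sI] := @MVT R phi dp 0 1 ltr01 dphi' phic.
rewrite /dp; move: sI.
rewrite in_itv /= => /andP[s0 _]; rewrite phi'0 // mul0r => /eqP.
rewrite subr_eq0 => /eqP E.
transitivity (phi 1).
  by apply: eq_Rintegral => z _; rewrite /f dil1.
rewrite E -RintegralZl //; last exact: (supp_integrable ck sk).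
by apply: eq_Rintegral => z _; rewrite /f dil0.
Qed.

End mean_value_property.

(** * Discs and the gradient estimate *)

Section discs.
Context {R : realType}.
Implicit Types (u v : R * R -> R) (z w : R * R).

Definition open_disc (c : R * R) (rho : R) : set (plane R) := [set z | sqdist z c < rho ^+ 2].

Lemma open_disc_measurable c rho : measurable (open_disc c rho).
Proof.
apply: open_plane_measurable.
have -> : open_disc c rho = (fun z => sqdist z c) @^-1` [set x | x < rho ^+ 2].
  by apply/seteqP; split.
move/continuousP: (@cont_sqdist R c); apply; exact: open_lt.
Qed.

Lemma open_disc_box c rho z : 0 < rho -> open_disc c rho z ->
  `|z.1 - c.1| <= rho /\ `|z.2 - c.2| <= rho.
Proof.
rewrite /open_disc /= /sqdist => r0 h.
have H (x : R) : x ^+ 2 <= rho ^+ 2 -> `|x| <= rho.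
  by rewrite -(real_normK (num_real x)) ler_sqr ?nnegrE // ltW.
have := sqr_ge0 (z.1 - c.1); have := sqr_ge0 (z.2 - c.2) => h1 h2.
by split; apply: H; lra.
Qed.

Lemma cont_integrable_box (f : R * R -> R) (D : set (plane R)) c (r : R) :
  continuous f -> measurable D ->
  (forall z, D z -> `|z.1 - c.1| <= r /\ `|z.2 - c.2| <= r) ->
  (area R).-integrable D (EFin \o f).
Proof.
move=> cf mD DB.
apply: measurable_bounded_integrable => //.
- pose I1 : set (measurableTypeR R) := `[c.1 - r, c.1 + r]%classic.
  pose I2 : set (measurableTypeR R) := `[c.2 - r, c.2 + r]%classic.
  have m1 : measurable I1 by exact: measurable_itv.
  have m2 : measurable I2 by exact: measurable_itv.
  apply: (@le_lt_trans _ _ (area R (I1 `*` I2))).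
    apply: le_measure; rewrite ?inE //; first exact: measurableX.
    move=> z /DB[z1 z2]; split; rewrite /I1 /I2 /= in_itv /=.
      by move: z1; rewrite ler_norml; lra.
    by move: z2; rewrite ler_norml; lra.
  rewrite areaX // !lebesgue_measure_itv /=.
  by do 2 case: ifP => _; rewrite ?mule0 ?mul0e // -!EFinD -EFinM ltry.
- exact: measurable_funS (continuous_plane_measurable cf).
- have [M M0 B] := cont_bounded_box c r cf.
  exists M; split; first exact: num_real.
  move=> x Mx z /DB[z1 z2]; exact: le_trans (B z z1 z2) (ltW Mx).
Qed.

Lemma cont_integrable_disc (f : R * R -> R) c rho : continuous f -> 0 < rho ->
  (area R).-integrable (open_disc c rho) (EFin \o f).
Proof.
move=> cf r0; apply: (@cont_integrable_box f _ c rho) => //.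
  exact: open_disc_measurable.
by move=> z; exact: open_disc_box.
Qed.

(** The lower bound depends on [rho] only, which makes the constants in the
    gradient estimate uniform in the centre. *)
Lemma cutoff_mass c rho : 0 < rho ->
  rho ^+ 6 / 16 <= \int[area R]_z cutoff c rho z.
Proof.
move=> r0.
pose I1 : set (measurableTypeR R) := `[c.1, c.1 + rho / 2]%classic.
pose I2 : set (measurableTypeR R) := `[c.2, c.2 + rho / 2]%classic.
have m1 : measurable I1 by exact: measurable_itv.
have m2 : measurable I2 by exact: measurable_itv.
have mI : measurable (I1 `*` I2) by exact: measurableX.
have ck := @cont_cutoff R c rho.
have ik := supp_integrable ck (@cutoff_supp R c rho r0).
rewrite -lee_fin /Rintegral fineK; last exact: integrable_fin_num.
have -> : ((rho ^+ 6 / 16)%:E =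
    \int[area R]_(z in I1 `*` I2) (cst (rho ^+ 4 / 4)%:E) z)%E.
  rewrite integral_cst //= areaX // !lebesgue_measure_itv /= !lte_fin.
  rewrite !ltrDl !divr_gt0 // -!EFinD -!EFinM; congr EFin.
  rewrite ![_ + rho / 2 - _]addrAC !subrr !add0r; by field.
have mk := continuous_plane_measurable ck.
apply: (@le_trans _ _ (\int[area R]_(z in I1 `*` I2) (cutoff c rho z)%:E)%E).
  apply: ge0_le_integral => //.
  - by move=> z _; rewrite lee_fin divr_ge0 // exprn_ge0 // ltW.
  - exact: (measurable_funS measurableT (@subsetT _ _) (measurable_int _ ik)).
  move=> z [z1 z2]; rewrite lee_fin /cutoff /pospart.
  have H : rho ^+ 2 / 2 <= rho ^+ 2 - sqdist z c.
    have S (x : R) : 0 <= x <= rho / 2 -> x ^+ 2 <= rho ^+ 2 / 4.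
      move=> /andP[x0 xr]; have -> : rho ^+ 2 / 4 = (rho / 2) ^+ 2 by field.
      by rewrite ler_sqr // ?nnegrE // divr_ge0 // ltW.
    have h1 : (z.1 - c.1) ^+ 2 <= rho ^+ 2 / 4.
      by apply: S; move: z1; rewrite /I1 /= in_itv /=; lra.
    have h2 : (z.2 - c.2) ^+ 2 <= rho ^+ 2 / 4.
      by apply: S; move: z2; rewrite /I2 /= in_itv /=; lra.
    by rewrite /sqdist; lra.
  have H0 : 0 <= rho ^+ 2 / 2 by rewrite divr_ge0 // sqr_ge0.
  have -> : rho ^+ 4 / 4 = (rho ^+ 2 / 2) ^+ 2 by field.
  rewrite ler_sqr ?nnegrE //; last by rewrite le_max lexx.
  by rewrite le_max H orbT.
apply: ge0_subset_integral => //.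
- exact: (measurable_int _ ik).
- by move=> z _; rewrite lee_fin cutoff_ge0.
Qed.

Lemma expcos_le (p q k s t l c1 c2 : R) z :
  `|expcos p q k s t l c1 c2 z| <= expR (affine p q k z) * (`|c1| + `|c2|).
Proof.
rewrite /expcos normrM ger0_norm ?expR_ge0 // ler_wpM2l ?expR_ge0 //.
rewrite (le_trans (ler_normD _ _)) // !normrM lerD // ler_piMr //.
  by rewrite ler_norml cos_geN1 cos_le1.
by rewrite ler_norml sin_geN1 sin_le1.
Qed.

End discs.

Section gradient_estimate.
Context {R : realType}.
Implicit Types (u v : R * R -> R) (z w : R * R).

Definition gauss_weight (al : R) (z : R * R) : R :=
  expR (- (al / 2 * (z.1 ^+ 2 + z.2 ^+ 2))).

Lemma cont_gauss_weight al : continuous (gauss_weight al).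
Proof.
have c2 := contD2 (contM2 (@cont_fst R) (@cont_fst R)) (contM2 (@cont_snd R) (@cont_snd R)).
exact (cont_comp (@continuous_expR R) (contN2 (contM2 (@cont_cst R (al / 2)) c2))).
Qed.

Lemma cont_norm (u : R * R -> R) : continuous u -> continuous (fun z => `|u z|).
Proof. by move=> cu z; apply: cvg_norm; exact: cu. Qed.

Lemma cont_norm_gauss_weight al (u : R * R -> R) : continuous u ->
  continuous (fun z => `|u z| * gauss_weight al z).
Proof. by move=> cu; exact (contM2 (cont_norm cu) (@cont_gauss_weight al)). Qed.

(** The holomorphic function [(u_x - i u_y) (d1 + i d2) exp (- beta (z - c))]
    with [beta = alpha conj(c)] has the wanted directional derivative as its real
    part at [c]. After the mean value property, an integration by parts moves
    the derivatives from [u] to the kernel; each derivative of the exponential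
    costs a factor [|beta| = alpha |c|]. The modulus of the exponential turns
    the weight at [c] into the weight at [z]. *)
Lemma gradient_estimate_dir (al rho d1 d2 : R) (c : R * R)
    (u ux uy uxx uxy uyy : R * R -> R) :
  0 < al -> 0 < rho -> `|d1| + `|d2| <= 1 ->
  gradc u ux uy -> gradc ux uxx uxy -> gradc uy uxy uyy ->
  (forall z, uyy z = - uxx z) ->
  rho ^+ 6 / 16 * `|ux c * d1 + uy c * d2| * gauss_weight al c <=
  (2 * rho ^+ 4 + 8 * rho ^+ 3) * expR (al / 2 * rho ^+ 2) *
    (1 + al * (`|c.1| + `|c.2|)) *
    \int[area R]_(z in open_disc c rho) (`|u z| * gauss_weight al z).
Proof.
move=> a0 r0 d12 gu gux guy Hlap.
pose b1 := al * c.1; pose b2 := al * c.2.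
pose p := - b1; pose q := - b2; pose k := b1 * c.1 + b2 * c.2.
pose s := - b2; pose t := b1; pose l := b2 * c.1 - b1 * c.2.
(* [F a b] is the real part of [(a + i b) exp (- beta (z - c))], with
   [beta = b1 - i b2]; the harmonic conjugates correspond to [(b, - a)]. *)
pose F a b := expcos p q k s t l a b.
have gF a b := gradc_expcos p q k s t l a b.
have gc := gradc_cutoff c rho.
have G1 := gradcD (gradcM gux (gF d1 d2)) (gradcM guy (gF d2 (- d1))).
have G2 := gradcD (gradcM gux (gF d2 (- d1))) (gradcM guy (gF (- d1) (- d2))).
have MV := mean_value_CR c G1 G2 _ _ r0.
have {MV} MV : \int[area R]_z ((ux z * F d1 d2 z + uy z * F d2 (- d1) z) * cutoff c rho z)
   = (ux c * d1 + uy c * d2) * \int[area R]_z cutoff c rho z.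
  rewrite [LHS]MV; first last.
  - by move=> z; rewrite /expcos Hlap /p /q /s /t; ring.
  - by move=> z; rewrite /expcos Hlap /p /q /s /t; ring.
  have A0 : affine p q k c = 0 by rewrite /affine /p /q /k; ring.
  have B0 : affine s t l c = 0 by rewrite /affine /s /t /l; ring.
  rewrite /expcos A0 B0 expR0 cos0 sin0; ring.
pose fx z := u z * (F d1 d2 z * (- 4 * (z.1 - c.1) * pospart c rho z) +
   cutoff c rho z * F (p * d1 + s * d2) (p * d2 - s * d1) z) + F d1 d2 z * cutoff c rho z * ux z.
pose fy z := u z * (F d2 (- d1) z * (- 4 * (z.2 - c.2) * pospart c rho z) +
   cutoff c rho z * F (q * d2 + t * - d1) (q * - d1 - t * d2) z) + F d2 (- d1) z * cutoff c rho z * uy z.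
have [dx _ cfx _] : gradc _ fx _ := gradcM gu (gradcM (gF d1 d2) gc).
have [_ dy _ cfy] : gradc _ _ fy := gradcM gu (gradcM (gF d2 (- d1)) gc).
have s0 := @pospart_supp R c rho r0; have s1 := @cutoff_supp R c rho r0.
have E1 : \int[area R]_z fx z = 0.
  apply: (Rintegral_pdx_supp r0 dx cfx (c := c)) => z zo.
    by rewrite /= s1 // !mulr0.
  by rewrite /fx s1 // s0 // ?(mulr0, mul0r, addr0).
have E2 : \int[area R]_z fy z = 0.
  apply: (Rintegral_pdy_supp r0 dy cfy (c := c)) => z zo.
    by rewrite /= s1 // !mulr0.
  by rewrite /fy s1 // s0 // ?(mulr0, mul0r, addr0).
(* [K] is the divergence of the kernel; it collects the terms of [fx + fy]
   that multiply [u]. *)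
pose K z := (F d1 d2 z * (- 4 * (z.1 - c.1) * pospart c rho z) +
   cutoff c rho z * F (p * d1 + s * d2) (p * d2 - s * d1) z) +
   (F d2 (- d1) z * (- 4 * (z.2 - c.2) * pospart c rho z) +
   cutoff c rho z * F (q * d2 + t * - d1) (q * - d1 - t * d2) z).
have [_ _ ckx cky] := gc.
have cF a b : continuous (F a b) by exact (@cont_expcos R p q k s t l a b).
have ck := @cont_cutoff R c rho.
have cK : continuous K.
  exact (contD2 (contD2 (contM2 (cF _ _) ckx) (contM2 ck (cF _ _)))
    (contD2 (contM2 (cF _ _) cky) (contM2 ck (cF _ _)))).
have cu := gradc_continuous gu.
have sfx : supp_in c rho fx.
  by move=> z zo; rewrite /fx s1 // s0 // ?(mulr0, mul0r, addr0).
have sfy : supp_in c rho fy.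
  by move=> z zo; rewrite /fy s1 // s0 // ?(mulr0, mul0r, addr0).
have sK : supp_in c rho K.
  by move=> z zo; rewrite /K s1 // s0 // ?(mulr0, mul0r, addr0).
have suK : supp_in c rho (fun z => u z * K z) by exact: supp_inM.
have ifx := supp_integrable cfx sfx; have ify := supp_integrable cfy sfy.
have iuK := supp_integrable (contM2 cu cK) suK.
have {}MV : (ux c * d1 + uy c * d2) * \int[area R]_z cutoff c rho z
    = - \int[area R]_z (u z * K z).
  rewrite -MV; apply/eqP; rewrite -subr_eq0 opprK; apply/eqP.
  have cH : continuous (fun z => (ux z * F d1 d2 z + uy z * F d2 (- d1) z) * cutoff c rho z).
    have [_ _ _ _] := gux; have cux := gradc_continuous gux; have cuy := gradc_continuous guy.
    exact (contM2 (contD2 (contM2 cux (cF _ _)) (contM2 cuy (cF _ _))) ck).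
  have iH := supp_integrable cH (supp_inM (fun z => ux z * F d1 d2 z + uy z * F d2 (- d1) z) s1).
  rewrite -(RintegralD measurableT iH iuK).
  transitivity (\int[area R]_z (fx z + fy z)).
    by apply: eq_Rintegral => z _; rewrite /fx /fy /K; ring.
  by rewrite (RintegralD measurableT ifx ify) E1 E2 addr0.
have mD := @open_disc_measurable R c rho.
have w0 z : 0 <= gauss_weight al z by exact: expR_ge0.
have m0 := cutoff_mass c r0.
have N1 : `|ux c * d1 + uy c * d2| * \int[area R]_z cutoff c rho z
    <= \int[area R]_(z in open_disc c rho) `|u z * K z|.
  rewrite -[X in _ * X <= _]ger0_norm; last first.
    by apply: le_trans m0; rewrite divr_ge0 // exprn_ge0 // ltW.
  rewrite -normrM MV normrN.
  rewrite (le_trans (le_normr_Rintegral measurableT iuK)) //.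
  rewrite [leRHS]Rintegral_mkcond le_eqVlt; apply/orP; left; apply/eqP.
  apply: eq_Rintegral => z _; rewrite patchE; case: ifPn => //.
  rewrite notin_setE /open_disc /= => /negP; rewrite -leNgt => zo.
  have P0 := pospart_out zo.
  by rewrite /K /cutoff P0 expr2 ?(mulr0, mul0r, addr0) normr0.
have N2 : \int[area R]_(z in open_disc c rho) (gauss_weight al c * `|u z * K z|) <=
    \int[area R]_(z in open_disc c rho) ((2 * rho ^+ 4 + 8 * rho ^+ 3) * expR (al / 2 * rho ^+ 2) *
    (1 + al * (`|c.1| + `|c.2|)) * (`|u z| * gauss_weight al z)).
  apply: le_Rintegral => //.
  - apply: cont_integrable_disc r0.
    exact (contM2 (@cont_cst R _) (cont_norm (contM2 cu cK))).
  - apply: cont_integrable_disc r0.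
    exact (contM2 (@cont_cst R _) (cont_norm_gauss_weight cu)).
  move=> z zD; have [z1 z2] := open_disc_box r0 zD.
  have eA : gauss_weight al c * expR (affine p q k z) <= expR (al / 2 * rho ^+ 2) * gauss_weight al z.
    rewrite -!expRD ler_expR /affine /p /q /k /b1 /b2.
    move: zD; rewrite /open_disc /= /sqdist => /ltW zD.
    have := ler_wpM2l (ltW a0) zD; lra.
  have pr := pospart_le c rho z; have p0 := pospart_ge0 c rho z.
  have kr : cutoff c rho z <= rho ^+ 4.
    have -> : rho ^+ 4 = (rho ^+ 2) ^+ 2 by ring.
    by rewrite /cutoff ler_sqr ?nnegrE // sqr_ge0.
  have Kz : `|K z| <= expR (affine p q k z) *
     ((2 * rho ^+ 4 + 8 * rho ^+ 3) * (1 + al * (`|c.1| + `|c.2|))).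
    set e := expR _; set L := al * (`|c.1| + `|c.2|).
    have e0 : 0 <= e by exact: expR_ge0.
    have L0 : 0 <= L by rewrite mulr_ge0 ?(ltW a0) // addr_ge0.
    have F1 e1 e2 : `|e1| + `|e2| <= 1 -> `|F e1 e2 z| <= e.
      by move=> e12; rewrite (le_trans (expcos_le _ _ _ _ _ _ _ _ _)) // ler_piMr.
    have F2 p' s' e1 e2 : `|e1| + `|e2| <= 1 -> `|p'| + `|s'| <= L ->
        `|F (p' * e1 + s' * e2) (p' * e2 - s' * e1) z| <= e * L.
      move=> e12 ps; rewrite (le_trans (expcos_le _ _ _ _ _ _ _ _ _)) // ler_wpM2l //.
      have X1 := ler_normD (p' * e1) (s' * e2).
      have X2 := ler_normB (p' * e2) (s' * e1).
      rewrite !normrM in X1 X2.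
      apply: (@le_trans _ _ ((`|p'| + `|s'|) * (`|e1| + `|e2|))); first by lra.
      rewrite (le_trans _ ps) // ler_piMr // addr_ge0 //.
    have d21 : `|d2| + `|- d1| <= 1 by rewrite normrN addrC.
    have ps : `|p| + `|s| <= L.
      by rewrite /p /s /b1 /b2 !normrN !normrM (gtr0_norm a0) -mulrDr.
    have qt : `|q| + `|t| <= L.
      by rewrite /q /t /b1 /b2 normrN !normrM (gtr0_norm a0) -mulrDr addrC.
    have T1 (f x : R) : `|f| <= e -> `|x| <= rho ->
        `|f * (- 4 * x * pospart c rho z)| <= e * (4 * rho ^+ 3).
      move=> fe xr; rewrite !normrM (ger0_norm p0) normrN (@ger0_norm _ 4) //.
      have -> : 4 * rho ^+ 3 = 4 * rho * rho ^+ 2 by ring.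
      by do ![apply: ler_pM => //]; rewrite ?mulr_ge0.
    have T2 (f : R) : `|f| <= e * L -> `|cutoff c rho z * f| <= e * (rho ^+ 4 * L).
      move=> fe; rewrite normrM (ger0_norm (cutoff_ge0 _ _ _)) mulrCA.
      by apply: ler_pM => //; exact: cutoff_ge0.
    have Y1 := T1 _ _ (F1 _ _ d12) z1.
    have Y2 := T2 _ (F2 _ _ _ _ d12 ps).
    have Y3 := T1 _ _ (F1 _ _ d21) z2.
    have Y4 := T2 _ (F2 _ _ _ _ d21 qt).
    apply: (@le_trans _ _ (e * (4 * rho ^+ 3) + e * (rho ^+ 4 * L)
      + (e * (4 * rho ^+ 3) + e * (rho ^+ 4 * L)))).
      rewrite /K (le_trans (ler_normD _ _)) // lerD //.
        by rewrite (le_trans (ler_normD _ _)) // lerD.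
      by rewrite (le_trans (ler_normD _ _)) // lerD.
    rewrite -!mulrDr ler_wpM2l //.
    have r1 := exprn_ge0 4 (ltW r0); have r2 := exprn_ge0 3 (ltW r0).
    have r3 := mulr_ge0 r2 L0; lra.
  rewrite normrM.
  rewrite (_ : gauss_weight al c * _ = `|u z| * (gauss_weight al c * `|K z|)); last by ring.
  rewrite (_ : _ * (`|u z| * _) = `|u z| * ((expR (al / 2 * rho ^+ 2) * gauss_weight al z) *
    ((2 * rho ^+ 4 + 8 * rho ^+ 3) * (1 + al * (`|c.1| + `|c.2|))))); last by ring.
  apply: ler_wpM2l => //.
  apply: (le_trans (ler_wpM2l (w0 c) Kz)).
  rewrite [leLHS]mulrA; apply: ler_wpM2r => //.
  have r1 := exprn_ge0 4 (ltW r0); have r2 := exprn_ge0 3 (ltW r0).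
  have := ltW a0; have := normr_ge0 c.1; have := normr_ge0 c.2 => n2 n1 al0.
  have n3 : 0 <= al * (`|c.1| + `|c.2|) by rewrite mulr_ge0 // addr_ge0.
  by apply: mulr_ge0; lra.
rewrite !RintegralZl // in N2; last 2 first.
- by apply: cont_integrable_disc r0; exact (cont_norm_gauss_weight cu).
- by apply: cont_integrable_disc r0; exact (cont_norm (contM2 cu cK)).
apply: le_trans N2; rewrite mulrC ler_wpM2l // (le_trans _ N1) //.
by rewrite mulrC ler_wpM2l.
Qed.

End gradient_estimate.

(** * The weighted local estimate for harmonic functions *)

Section pointwise.
Context {R : realType}.
Implicit Types (u v : R * R -> R) (z w : R * R).

Lemma Rintegral_subset_le (A B : set (plane R)) (f : R * R -> R) :
  measurable A -> measurable B -> (area R).-integrable B (EFin \o f) ->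
  (forall z, 0 <= f z) -> A `<=` B ->
  \int[area R]_(z in A) f z <= \int[area R]_(z in B) f z.
Proof.
move=> mA mB iB f0 AB.
have iA := integrableS mB mA AB iB.
rewrite /Rintegral; apply: fine_le.
- exact: integrable_fin_num.
- exact: integrable_fin_num.
- apply: ge0_subset_integral => //.
  + exact: (measurable_int _ iB).
  + by move=> z _; rewrite lee_fin.
Qed.

(** [f + B exp (- k s)] and [- f + B exp (- k s)] are nonincreasing; the
    bound obtained is uniform in [k]. *)
Lemma expdecay_bound (f f' : R -> R) (B k : R) : 0 <= B ->
  (forall s, is_derive s (1 : R) f (f' s)) ->
  (forall s, 0 <= s <= 1 -> `|f' s| <= B * k * expR (- (k * s))) ->
  `|f 0| <= `|f 1| + B.
Proof.
move=> B0 df fb.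
have H (g g' : R -> R) : (forall s, is_derive s (1 : R) g (g' s)) ->
    (forall s, 0 <= s <= 1 -> g' s <= B * k * expR (- (k * s))) -> g 1 - g 0 <= B.
  move=> dg gb.
  pose h (s : R) := g s + B * expR (- (k * s)).
  have dh s : is_derive s (1 : R) h (g' s - B * k * expR (- (k * s))).
    have d1 : is_derive s (1 : R) (fun t : R => - (k * t)) (- k).
      by apply: is_derive_eq; rewrite /GRing.scale /=; ring.
    have d2 := @comp_derive R expR (fun t : R => - (k * t)) s _ _ (is_derive_expR _) d1.
    have d3 := dg s.
    set e := (fun t : R => expR _) in d2.
    refine (@is_derive_eq R R R (fun v : R => g v + B * e v) s 1 _ _ _ _).
    rewrite /e /GRing.scale /=; ring.
  have ch : {within `[0, 1], continuous h}.
    by apply: derivable_within_continuous => t _; have d := dh t; exact: ex_derive.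
  have [c cI E] := @MVT R h _ 0 1 ltr01 (fun s _ => dh s) ch.
  move: cI; rewrite in_itv /= => /andP[c0 c1].
  have := gb c; rewrite (ltW c0) (ltW c1) => /(_ isT) gc.
  have e1 : 0 <= B * expR (- (k * 1)) by rewrite mulr_ge0 // expR_ge0.
  move: E e1; rewrite /h mulr0 oppr0 expR0 !mulr1 addr0 !mulr1 => E e1; lra.
have H1 : f 1 - f 0 <= B.
  by apply: (H f f' df) => s /fb; exact: le_trans (ler_norm _).
have H2 : - f 1 - (- f 0) <= B.
  apply: (H (fun s => - f s) (fun s => - f' s)
    (fun s => @is_deriveN R R R f s 1 _ (df s))).
  by move=> s /fb; apply: le_trans; rewrite -normrN ler_norm.
have : `|f 0| <= `|f 0 - f 1| + `|f 1| by rewrite -{1}(subrK (f 1) (f 0)) ler_normD.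
have : `|f 0 - f 1| <= B by rewrite ler_norml; lra.
lra.
Qed.

Section fixed_function.
Variables (al r : R).
Hypotheses (al0 : 0 < al) (r0 : 0 < r).
Let rho := r / 2.
Let d := r / 4.
Let Crho := (2 * rho ^+ 4 + 8 * rho ^+ 3) * expR (al / 2 * rho ^+ 2).
Variables (u ux uy uxx uxy uyy : R * R -> R).
Hypotheses (gu : gradc u ux uy) (gux : gradc ux uxx uxy) (guy : gradc uy uxy uyy).
Hypothesis Hlap : forall z, uyy z = - uxx z.

Let I0 w := \int[area R]_(z in open_disc w r) (`|u z| * gauss_weight al z).

Let nw_ge0 z : 0 <= `|u z| * gauss_weight al z.
Proof. by rewrite mulr_ge0 // expR_ge0. Qed.

Let rho0 : 0 < rho. Proof. by rewrite divr_gt0. Qed.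
Let d0 : 0 < d. Proof. by rewrite divr_gt0. Qed.

Let I0_ge0 w : 0 <= I0 w.
Proof. by apply: Rintegral_ge0 => z _; exact: nw_ge0. Qed.

Let Crho0 : 0 <= Crho.
Proof.
have r1 := exprn_ge0 4 (ltW rho0); have r2 := exprn_ge0 3 (ltW rho0).
by apply: mulr_ge0; [lra|exact: expR_ge0].
Qed.

(** Discs of radius [r / 2] around points of the square of half-side [r / 4]
    stay in the disc of radius [r], by [|x + y|^2 <= 2 |x|^2 + 2 |y|^2]. *)
Lemma subdisc w (v : R * R) : `|v.1 - w.1| <= d -> `|v.2 - w.2| <= d ->
  open_disc v rho `<=` open_disc w r.
Proof.
have H (x : R) : `|x| <= d -> x ^+ 2 <= d ^+ 2.
  by rewrite -(real_normK (num_real x)) ler_sqr ?nnegrE // ltW.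
move=> /H h1 /H h2 z; rewrite /open_disc /= /sqdist => h3.
have E : r ^+ 2 = 4 * rho ^+ 2 by rewrite /rho; field.
have E' : r ^+ 2 = 16 * d ^+ 2 by rewrite /d; field.
have q1 := sqr_ge0 ((z.1 - v.1) - (v.1 - w.1)).
have q2 := sqr_ge0 ((z.2 - v.2) - (v.2 - w.2)).
have F1 : (z.1 - w.1) ^+ 2 = 2 * (z.1 - v.1) ^+ 2 + 2 * (v.1 - w.1) ^+ 2
   - ((z.1 - v.1) - (v.1 - w.1)) ^+ 2 by ring.
have F2 : (z.2 - w.2) ^+ 2 = 2 * (z.2 - v.2) ^+ 2 + 2 * (v.2 - w.2) ^+ 2
   - ((z.2 - v.2) - (v.2 - w.2)) ^+ 2 by ring.
have : 0 < r ^+ 2 by rewrite exprn_gt0.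
rewrite F1 F2; lra.
Qed.

Let grad_at w (v : R * R) (e1 e2 : R) : `|v.1 - w.1| <= d -> `|v.2 - w.2| <= d ->
  `|e1| <= d -> `|e2| <= d ->
  `|ux v * e1 + uy v * e2| * gauss_weight al v <=
   2 * d * (16 / rho ^+ 6) * Crho * (1 + 2 * al * d + al * (`|w.1| + `|w.2|)) * I0 w.
Proof.
move=> v1 v2 e1d e2d.
have d12 : `|e1 / (2 * d)| + `|e2 / (2 * d)| <= 1.
  have d2 : 0 < 2 * d by rewrite mulr_gt0.
  rewrite !normrM normfV (gtr0_norm d2) -mulrDl ler_pdivrMr // mul1r; lra.
have := gradient_estimate_dir v al0 rho0 d12 gu gux guy Hlap.
have -> : ux v * (e1 / (2 * d)) + uy v * (e2 / (2 * d)) = (ux v * e1 + uy v * e2) / (2 * d).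
  by field; rewrite gt_eqF.
have d2 : 0 < 2 * d by rewrite mulr_gt0.
rewrite normrM normfV (gtr0_norm d2); set X := `|ux v * e1 + _|.
set I1 := Rintegral _ _ _ => H.
have c0 : 0 < 2 * d * (16 / rho ^+ 6).
  by rewrite !mulr_gt0 // invr_gt0 exprn_gt0.
have := ler_wpM2l (ltW c0) H.
have -> : 2 * d * (16 / rho ^+ 6) * (rho ^+ 6 / 16 * (X / (2 * d)) * gauss_weight al v) = X * gauss_weight al v.
  by field; rewrite !gt_eqF.
move=> /le_trans; apply.
rewrite -/Crho; set cc := 2 * d * (16 / rho ^+ 6) in c0 *.
rewrite -[Crho * _ * I1]mulrA [leLHS]mulrA -[leRHS]mulrA.
apply: ler_wpM2l; first by rewrite mulr_ge0 // ltW.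
have n1 : `|v.1| <= `|w.1| + d.
  by rewrite -[v.1](subrK w.1) addrC (le_trans (ler_normD _ _)) // lerD2l.
have n2 : `|v.2| <= `|w.2| + d.
  by rewrite -[v.2](subrK w.2) addrC (le_trans (ler_normD _ _)) // lerD2l.
apply: ler_pM.
- by rewrite addr_ge0 // mulr_ge0 ?(ltW al0) // addr_ge0.
- by apply: Rintegral_ge0 => z _; exact: nw_ge0.
- have : al * (`|v.1| + `|v.2|) <= al * (`|w.1| + `|w.2| + 2 * d).
    by rewrite ler_pM2l //; lra.
  lra.
- apply: Rintegral_subset_le => //.
  + exact: open_disc_measurable.
  + exact: open_disc_measurable.
  + apply: cont_integrable_disc r0; exact (cont_norm_gauss_weight (gradc_continuous gu)).
  + exact: subdisc.
Qed.

Let Q := 2 * d * (16 / rho ^+ 6) * Crho.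
Let E := expR (al * d ^+ 2).
Let Kc := expR 1 * E * Q * (1 + 2 * al * d + 2 / d).

(** Towards the origin the weight grows exponentially at rate at least
    [al * d / 2 * (|w.1| + |w.2|)], up to the bounded factor [E]. *)
Let gauss_weight_seg w (s e1 e2 : R) : 0 <= s <= 1 -> `|e1| <= d -> `|e2| <= d ->
  w.1 * e1 <= - (d / 2 * `|w.1|) -> w.2 * e2 <= - (d / 2 * `|w.2|) ->
  gauss_weight al w <= gauss_weight al (w.1 + s * e1, w.2 + s * e2) *
    (E * expR (- (al * d / 2 * (`|w.1| + `|w.2|) * s))).
Proof.
move=> /andP[s0 s1] e1d e2d w1 w2.
rewrite -!expRD ler_expR /=.
have H (x : R) : `|x| <= d -> x ^+ 2 <= d ^+ 2.
  by rewrite -(real_normK (num_real x)) ler_sqr ?nnegrE // ltW.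
have q1 := H _ e1d; have q2 := H _ e2d.
have as0 : 0 <= al * s by rewrite mulr_ge0 // ltW.
have p1 := ler_wpM2l as0 w1; have p2 := ler_wpM2l as0 w2.
have s2 : s ^+ 2 <= 1 by rewrite expr_le1.
have e0 : 0 <= e1 ^+ 2 + e2 ^+ 2 by rewrite addr_ge0 // sqr_ge0.
have p3 : s ^+ 2 * (e1 ^+ 2 + e2 ^+ 2) <= 2 * d ^+ 2.
  by apply: (@le_trans _ _ (e1 ^+ 2 + e2 ^+ 2)); [rewrite ler_piMl|lra].
have p4 := ler_wpM2l (ltW al0) p3.
lra.
Qed.

(** Along the segment from [w] to [z] the derivative of [u] is at most of order
    [1 + |w|] against the weight at the moving point, hence at most
    [(1 + |w|) exp (- c |w| s)] against the weight at [w]; the total variation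
    is bounded uniformly in [w]. *)
Lemma pointwise_step w (z : R * R) : `|z.1 - w.1| <= d -> `|z.2 - w.2| <= d ->
  w.1 * (z.1 - w.1) <= - (d / 2 * `|w.1|) -> w.2 * (z.2 - w.2) <= - (d / 2 * `|w.2|) ->
  `|u w| * gauss_weight al w <= E * (`|u z| * gauss_weight al z) + Kc * I0 w.
Proof.
move=> z1 z2 w1 w2.
set e1 := z.1 - w.1 in z1 w1; set e2 := z.2 - w.2 in z2 w2.
pose p (s : R) : R * R := (w.1 + s * e1, w.2 + s * e2).
pose N := `|w.1| + `|w.2|; pose kap := al * d / 2 * N; pose k := 1 + kap.
have N0 : 0 <= N by rewrite addr_ge0.
have kap0 : 0 <= kap by rewrite !mulr_ge0 // ?ltW // divr_gt0.
have Q0 : 0 <= Q.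
  apply: mulr_ge0 => //; apply: mulr_ge0; first by rewrite mulr_ge0 // ltW.
  by rewrite divr_ge0 // exprn_ge0 // ltW.
have M0 : 0 <= 1 + 2 * al * d + 2 / d.
  have h1 := mulr_gt0 al0 d0; have h2 : 0 < 2 / d by rewrite divr_gt0.
  by lra.
have K0 : 0 <= Kc * I0 w.
  have EE0 : 0 <= E by exact: expR_ge0.
  apply: mulr_ge0; last exact: I0_ge0.
  apply: mulr_ge0; last exact: M0.
  apply: mulr_ge0; last exact: Q0.
  by apply: mulr_ge0 => //; exact: expR_ge0.
pose f (s : R) := u (p s) * gauss_weight al w.
pose f' (s : R) := (ux (p s) * e1 + uy (p s) * e2) * gauss_weight al w.
have df s : is_derive s (1 : R) f (f' s).
  have d1 := gradc_line w.1 w.2 e1 e2 s gu.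
  refine (@is_derive_eq R R R (fun v : R => u (w.1 + v * e1, w.2 + v * e2) * gauss_weight al w) s 1 _ _ _ _).
  rewrite /f' /p /GRing.scale /=; ring.
have fb s : 0 <= s <= 1 -> `|f' s| <= Kc * I0 w * k * expR (- (k * s)).
  move=> s01; have /andP[s0 s1] := s01.
  have v1 (x : R) : `|x| <= d -> `|s * x| <= d.
    by move=> xd; rewrite normrM (ger0_norm s0) (le_trans _ xd) // ler_piMl.
  have P1 : `|(p s).1 - w.1| <= d by rewrite /p /= addrAC subrr add0r v1.
  have P2 : `|(p s).2 - w.2| <= d by rewrite /p /= addrAC subrr add0r v1.
  have G := grad_at P1 P2 z1 z2.
  rewrite -/N -/Q in G.
  have W := gauss_weight_seg s01 z1 z2 w1 w2; rewrite -/N -/kap -/(p s) in W.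
  rewrite /f' normrM (ger0_norm (expR_ge0 _)).
  set X := `|_ + _| in G *.
  have X0 : 0 <= X by exact: normr_ge0.
  apply: (le_trans (ler_wpM2l X0 W)); rewrite [leLHS]mulrA.
  have ee0 : 0 <= E * expR (- (kap * s)) by rewrite mulr_ge0 // expR_ge0.
  apply: (le_trans (ler_wpM2r ee0 G)).
  have ek : expR (- (kap * s)) <= expR 1 * expR (- (k * s)).
    by rewrite -expRD ler_expR /k; lra.
  have Mk : 1 + 2 * al * d + al * N <= (1 + 2 * al * d + 2 / d) * k.
    have -> : al * N = 2 / d * kap by rewrite /kap; field; rewrite gt_eqF.
    rewrite /k mulrDr mulr1.
    have h1 : 0 <= 2 / d by rewrite divr_ge0 // ltW.
    have h2 : 0 <= (1 + 2 * al * d) * kap.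
      by rewrite mulr_ge0 // addr_ge0 // !mulr_ge0 // ltW.
    lra.
  (* The factor [1 + |w|] of the gradient estimate is at most a constant
     times the decay rate [k]; the [1] in [k] covers small [w]. *)
rewrite (_ : Kc * I0 w * k * _ = Q * ((1 + 2 * al * d + 2 / d) * k) * I0 w *
    (E * (expR 1 * expR (- (k * s))))); last by rewrite /Kc; ring.
  have n0 : 0 <= 1 + 2 * al * d + al * N by rewrite !addr_ge0 // !mulr_ge0 // ltW.
  apply: ler_pM => //.
  - exact: mulr_ge0 (mulr_ge0 Q0 n0) (I0_ge0 w).
  - by apply: ler_wpM2r; [exact: I0_ge0|exact: ler_wpM2l].
  - by apply: ler_wpM2l => //; exact: expR_ge0.
have p0 : p 0 = w by rewrite /p !mul0r !addr0; case: (w).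
have p1 : p 1 = z.
  by rewrite /p !mul1r /e1 /e2 !(addrC _ (_ - _)) !subrK; case: (z).
have := expdecay_bound K0 df fb.
rewrite /f p0 p1 !normrM !(ger0_norm (expR_ge0 _)) => /le_trans; apply.
rewrite lerD2r.
have one : 0 <= (1 : R) <= 1 by rewrite ler01 lexx.
have W := gauss_weight_seg one z1 z2 w1 w2; rewrite -/(p 1) p1 -/N -/kap in W.
apply: (le_trans (ler_wpM2l (normr_ge0 (u z)) W)).
rewrite [leRHS]mulrCA ler_wpM2l // [leRHS]mulrC ler_wpM2l ?expR_ge0 //.
by rewrite ler_piMr ?expR_ge0 // mulr1 -expR0 ler_expR oppr_le0.
Qed.

(** The preceding estimate is averaged over a square of side [d / 2] situated
    towards the origin, in each coordinate separately, as seen from [w]. *)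
Lemma pointwise_bound w :
  `|u w| * gauss_weight al w <= (4 * E / d ^+ 2 + Kc) * I0 w.
Proof.
(* The interval [[m x, m x + d / 2]] lies at distance between [d / 2] and [d]
   from [x], on the side of 0 (or beyond it). *)
pose m (x : R) := if 0 <= x then x - d else x + d / 2.
have mP (x y : R) : m x <= y <= m x + d / 2 ->
    `|y - x| <= d /\ x * (y - x) <= - (d / 2 * `|x|).
  rewrite /m; case: (leP 0 x) => x0 /andP[y1 y2].
    split; first by rewrite ler_norml; lra.
    have -> : - (d / 2 * `|x|) = x * (- (d / 2)) by rewrite ger0_norm //; ring.
    by rewrite ler_wpM2l //; lra.
  split; first by rewrite ler_norml; lra.
  have -> : - (d / 2 * `|x|) = x * (d / 2) by rewrite ltr0_norm //; ring.
  by rewrite ler_wnM2l // ?(ltW x0) //; lra.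
pose I1 : set (measurableTypeR R) := `[m w.1, m w.1 + d / 2]%classic.
pose I2 : set (measurableTypeR R) := `[m w.2, m w.2 + d / 2]%classic.
have m1 : measurable I1 by exact: measurable_itv.
have m2 : measurable I2 by exact: measurable_itv.
have mI : measurable (I1 `*` I2) by exact: measurableX.
have IP z : (I1 `*` I2) z -> [/\ `|z.1 - w.1| <= d, `|z.2 - w.2| <= d,
    w.1 * (z.1 - w.1) <= - (d / 2 * `|w.1|) & w.2 * (z.2 - w.2) <= - (d / 2 * `|w.2|)].
  by move=> [z1 z2]; move: z1 z2; rewrite /I1 /I2 /= !in_itv /= => /mP[? ?] /mP[? ?].
have Isub : I1 `*` I2 `<=` open_disc w r.
  move=> z /IP[z1 z2 _ _]; apply: (subdisc z1 z2).
  by rewrite /open_disc /= /sqdist !subrr expr0n /= addr0 exprn_gt0.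
have cg := cont_norm_gauss_weight (al := al) (gradc_continuous gu).
have cst_int (k : R) : \int[area R]_(z in I1 `*` I2) k = k * (d ^+ 2 / 4).
  rewrite /Rintegral integral_cst //= areaX // !lebesgue_measure_itv /= !lte_fin.
  rewrite !ltrDl !divr_gt0 // -!EFinD -!EFinM /=.
  by rewrite ![_ + d / 2 - _]addrAC !subrr !add0r; field.
have Ibox z : (I1 `*` I2) z -> `|z.1 - w.1| <= d /\ `|z.2 - w.2| <= d.
  by move=> /IP[].
have iG : (area R).-integrable (I1 `*` I2) (EFin \o (fun z => `|u z| * gauss_weight al z)).
  exact: cont_integrable_box cg mI Ibox.
have iEG : (area R).-integrable (I1 `*` I2) (EFin \o (fun z => E * (`|u z| * gauss_weight al z))).
  exact: cont_integrable_box (contM2 (@cont_cst R E) cg) mI Ibox.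
have ic (k : R) : (area R).-integrable (I1 `*` I2) (EFin \o (fun=> k)).
  exact: cont_integrable_box (@cont_cst R k) mI Ibox.
have : \int[area R]_(z in I1 `*` I2) (`|u w| * gauss_weight al w) <=
    \int[area R]_(z in I1 `*` I2) (E * (`|u z| * gauss_weight al z) + Kc * I0 w).
  apply: le_Rintegral => //.
    exact: cont_integrable_box (contD2 (contM2 (@cont_cst R E) cg) (@cont_cst R (Kc * I0 w))) mI Ibox.
  by move=> z /IP[z1 z2 z3 z4]; exact: pointwise_step.
rewrite RintegralD // RintegralZl // !cst_int.
have : \int[area R]_(z in I1 `*` I2) (`|u z| * gauss_weight al z) <= I0 w.
  apply: Rintegral_subset_le => //; first exact: open_disc_measurable.
  exact: cont_integrable_disc cg r0.
have E0 : 0 <= E by exact: expR_ge0.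
move=> /(ler_wpM2l E0) H1 H2.
have d20 : 0 < d ^+ 2 / 4 by rewrite divr_gt0 // exprn_gt0.
rewrite -(ler_pM2r d20) (le_trans H2) //.
have alg (a b i D : R) : D != 0 -> (4 * a / D + b) * i * (D / 4) = a * i + b * i * (D / 4).
  by move=> D0; field.
rewrite alg; last by rewrite expf_neq0 // gt_eqF.
by rewrite lerD2r.
Qed.

End fixed_function.

Theorem harmonic_pointwise (al r : R) : 0 < al -> 0 < r ->
  exists2 C : R, 0 < C & forall u, real_harmonic u -> forall w,
    `|u w| * gauss_weight al w <= C * \int[area R]_(z in open_disc w r) (`|u z| * gauss_weight al z).
Proof.
move=> al0 r0; eexists; last first.
  move=> u /real_harmonicE[ux [uy [uxx [uxy [uyy [gu gux guy lap]]]]]] w.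
  exact (pointwise_bound al0 r0 gu gux guy lap w).
have rho0 : 0 < r / 2 by rewrite divr_gt0.
have d0 : 0 < r / 4 by rewrite divr_gt0.
have r1 := exprn_gt0 4 rho0; have r2 := exprn_gt0 3 rho0.
rewrite addr_gt0 // ?mulr_gt0 ?expR_gt0 ?invr_gt0 ?exprn_gt0 //.
  by rewrite addr_gt0 // mulr_gt0.
by rewrite !addr_gt0 // ?mulr_gt0 // ?invr_gt0.
Qed.
End pointwise.

(** * Integration over discs against a measure *)

Section integration_over_discs.
Context {R : realType}.
Implicit Types (u v : R * R -> R) (z w : R * R).

Lemma sqdistC (z w : R * R) : sqdist z w = sqdist w z.
Proof. by rewrite /sqdist; ring. Qed.

(** Tonelli's theorem requires sigma-finiteness, which follows from the
    hypothesis on discs: those centred on the lattice of mesh [r / 2] cover. *)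
Lemma open_disc_cover_sigma_finite (mu : {measure set (plane R) -> \bar R}) (r C : R) :
  0 < r -> (forall z, (mu (open_disc z r) <= C%:E)%E) -> sigma_finite setT mu.
Proof.
move=> r0 muC.
pose h := r / 2.
have h0 : 0 < h by rewrite divr_gt0.
pose c (i : int * int) : R * R := (i.1%:~R * h, i.2%:~R * h).
pose F n : set (plane R) :=
  if unpickle n is Some i then open_disc (c i) r else set0.
exists F.
  apply/esym; rewrite -subTset => -[x y] _.
  suff [i ci] : exists i, open_disc (c i) r (x, y).
    by exists (pickle i); [exact: I|rewrite /F pickleK].
  exists (Num.floor (x / h), Num.floor (y / h)); rewrite /open_disc /sqdist /c.
  have H (t : R) : 0 <= t - (Num.floor (t / h))%:~R * h < h.
    have := floor_itv (t / h).
    rewrite ler_pdivlMr // ltr_pdivrMr // rmorphD /= mulrDl mul1r; lra.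
  have S (t : R) : 0 <= t < h -> t ^+ 2 < h ^+ 2.
    by move=> /andP[t0 th]; rewrite ltr_sqr // nnegrE // ltW.
  have E : r ^+ 2 = 4 * h ^+ 2 by rewrite /h; field.
  have h2 := exprn_gt0 2 h0; have Sx := S _ (H x); have Sy := S _ (H y).
  rewrite /mkset; cbn [fst snd]; rewrite E; lra.
move=> n; rewrite /F; case: unpickle => [i|].
  by split; [exact: open_disc_measurable|exact: le_lt_trans (muC _) (ltry _)].
by split => //; rewrite measure0.
Qed.

Lemma area_open_disc_le (z : R * R) (r : R) : 0 < r ->
  (area R (open_disc z r) <= (4 * r ^+ 2)%:E)%E.
Proof.
move=> r0.
pose I1 : set (measurableTypeR R) := `[z.1 - r, z.1 + r]%classic.
pose I2 : set (measurableTypeR R) := `[z.2 - r, z.2 + r]%classic.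
have m1 : measurable I1 by exact: measurable_itv.
have m2 : measurable I2 by exact: measurable_itv.
apply: (@le_trans _ _ (area R (I1 `*` I2))).
  apply: le_measure; rewrite ?inE //; [exact: open_disc_measurable|exact: measurableX|].
  move=> w /(open_disc_box r0)[w1 w2]; split; rewrite /I1 /I2 /= in_itv /=.
    by move: w1; rewrite ler_norml; lra.
  by move: w2; rewrite ler_norml; lra.
have H (x : R) : (x - r < x + r) by lra.
rewrite areaX // !lebesgue_measure_itv /= !lte_fin !H -!EFinD -EFinM lee_fin.
by rewrite le_eqVlt; apply/orP; left; apply/eqP; ring.
Qed.

(** Fubini's theorem takes a bundled sigma-finite measure, while the
    sigma-finiteness of [mu] is only derived from a bound on discs. *)
Definition sigma_finite_of (mu : {measure set (plane R) -> \bar R})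
    (sf : sigma_finite setT mu) : {sigma_finite_measure set (plane R) -> \bar R} :=
  HB.pack_for (SigmaFiniteMeasure.type (plane R) R) (Measure.sort mu)
    (isSFinite.Build _ _ _ _ (sfinite_measure_sigma_finite sf))
    (isSigmaFinite.Build _ _ _ _ sf).

Lemma measurable_open_disc_graph (r : R) :
  measurable ([set q | sqdist q.1 q.2 < r ^+ 2] : set (plane R * plane R)).
Proof.
have m11 : measurable_fun setT (fun q : plane R * plane R => q.1.1).
  exact: (measurableT_comp measurable_fst measurable_fst).
have m12 : measurable_fun setT (fun q : plane R * plane R => q.1.2).
  exact: (measurableT_comp measurable_snd measurable_fst).
have m21 : measurable_fun setT (fun q : plane R * plane R => q.2.1).
  exact: (measurableT_comp measurable_fst measurable_snd).
have m22 : measurable_fun setT (fun q : plane R * plane R => q.2.2).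
  exact: (measurableT_comp measurable_snd measurable_snd).
have m1 : measurable_fun setT (fun q : plane R * plane R => sqdist q.1 q.2).
  apply: measurable_funD; apply: measurable_funX; exact: measurable_funB.
rewrite -[X in measurable X]setTI.
have := m1 measurableT `]-oo, r ^+ 2[%classic (measurable_itv _).
by congr (measurable (_ `&` _)); apply/seteqP; split => q /=; rewrite in_itv.
Qed.

(** The integrand over pairs [(w, z)] with [z] in the disc of centre [w]; that
    relation is symmetric in [w] and [z]. *)
Definition disc_kernel (r : R) (f : plane R -> \bar R) : plane R * plane R -> \bar R :=
  (fun q => f q.2) \_ [set q | sqdist q.1 q.2 < r ^+ 2].

Lemma measurable_disc_kernel (r : R) (f : plane R -> \bar R) :
  measurable_fun setT f -> measurable_fun setT (disc_kernel r f).
Proof.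
move=> mf; apply/(measurable_restrictT _ (measurable_open_disc_graph r)).
apply: measurable_funTS; exact: (measurableT_comp mf measurable_snd).
Qed.

Lemma disc_kernel_ge0 (r : R) (f : plane R -> \bar R) q :
  (forall z, 0 <= f z)%E -> (0 <= disc_kernel r f q)%E.
Proof. by move=> f0; rewrite /disc_kernel patchE; case: ifP. Qed.

Lemma disc_kernelE (m : {measure set (plane R) -> \bar R}) (r : R)
    (f : plane R -> \bar R) w :
  (\int[m]_z disc_kernel r f (w, z) = \int[m]_(z in open_disc w r) f z)%E.
Proof.
rewrite [RHS]integral_mkcond; apply: eq_integral => z _.
rewrite /disc_kernel !patchE /=.
by congr (if _ then _ else _); apply/idP/idP; rewrite !inE /open_disc /= sqdistC.
Qed.

Definition sigma_finite_area : {sigma_finite_measure set (plane R) -> \bar R} :=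
  sigma_finite_of (open_disc_cover_sigma_finite ltr01
    (fun z => area_open_disc_le z ltr01)).

Lemma measurable_disc_integral (r : R) (f : plane R -> \bar R) :
  measurable_fun setT f -> (forall z, 0 <= f z)%E ->
  measurable_fun setT (fun w : plane R => \int[area R]_(z in open_disc w r) f z)%E.
Proof.
move=> mf f0.
have := @measurable_fun_fubini_tonelli_F _ _ (plane R) (plane R) R sigma_finite_area
  _ (measurable_disc_kernel r mf) (fun q => disc_kernel_ge0 r q f0).
congr measurable_fun; apply/funext => w; exact: (disc_kernelE sigma_finite_area).
Qed.

(** After exchanging the integrals, [f z] is multiplied by the mass of the
    disc of centre [z]. *)
Lemma tonelli_discs (mu : {measure set (plane R) -> \bar R}) (r C : R)
    (f : plane R -> \bar R) :
  0 < r -> (forall z, (mu (open_disc z r) <= C%:E)%E) ->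
  measurable_fun setT f -> (forall z, 0 <= f z)%E ->
  (\int[mu]_w \int[area R]_(z in open_disc w r) f z <= C%:E * \int[area R]_z f z)%E.
Proof.
move=> r0 muC mf f0.
pose mu' := sigma_finite_of (open_disc_cover_sigma_finite r0 muC).
have mG := measurable_disc_kernel r mf.
have G0 q := disc_kernel_ge0 r q f0.
have := @fubini_tonelli _ _ (plane R) (plane R) R mu' sigma_finite_area
  (disc_kernel r f) mG G0.
have -> : (\int[mu']_x \int[sigma_finite_area]_y disc_kernel r f (x, y)
  = \int[mu]_w \int[area R]_(z in open_disc w r) f z)%E.
  by apply: eq_integral => w _; exact: (disc_kernelE sigma_finite_area).
move=> ->.
have mC0 : (0 <= C%:E)%E.
  by apply: le_trans (muC (0, 0)); exact: measure_ge0.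
rewrite -(ge0_integralZl _ measurableT mf (fun z _ => f0 z) mC0).
apply: ge0_le_integral => //.
- by move=> z _; exact: integral_ge0.
- have := @measurable_fun_fubini_tonelli_G _ _ (plane R) (plane R) R mu' _ mG G0.
  exact.
- exact: measurable_funeM.
move=> z _.
have -> : (\int[mu']_x disc_kernel r f (x, z) = \int[mu]_(w in open_disc z r) cst (f z) w)%E.
  rewrite [RHS]integral_mkcond; apply: eq_integral => w _.
  rewrite /disc_kernel !patchE /=.
  by congr (if _ then _ else _); apply/idP/idP; rewrite !inE /open_disc /=.
rewrite integral_cst; last exact: open_disc_measurable.
by rewrite muleC; apply: lee_wpmul2r.
Qed.

End integration_over_discs.

(** * Powers and the embedding theorem *)

Section powers.
Context {R : realType}.
Implicit Types (u v : R * R -> R) (z w : R * R).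

Lemma le_young (p l x : R) : 1 <= p -> 0 < l -> 0 <= x ->
  x <= l + x `^ p / l `^ (p - 1).
Proof.
move=> p1 l0 x0; have [xl|lx] := leP x l.
  by rewrite (le_trans xl) // lerDl divr_ge0 // powR_ge0.
have p10 : 0 <= p - 1 by rewrite subr_ge0.
have xp : 0 < x by exact: lt_trans lx.
have lp : 0 < l `^ (p - 1) by exact: powR_gt0.
suff : x <= x `^ p / l `^ (p - 1) by lra.
rewrite ler_pdivlMr //.
have -> : x `^ p = x * x `^ (p - 1).
  rewrite -{2}(powRr1 x0) -powRD; last by rewrite (gt_eqF xp) implybT.
  by rewrite addrC subrK.
by rewrite ler_pM2l // ge0_ler_powR // ?nnegrE ?ltW.
Qed.

(** By [le_young], [a <= C (l V + l^(1 - p) J)] for every [l > 0]; the choice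
    [l = a / (2 C V)] makes the first term half of the left-hand side. This
    replaces Jensen's inequality. *)
Lemma average_powR (p C V a : R) (g : R * R -> R) (D : set (plane R)) :
  1 <= p -> 0 < C -> 0 < V -> 0 <= a -> continuous g -> (forall z, 0 <= g z) ->
  measurable D -> (area R D <= V%:E)%E ->
  (a%:E <= C%:E * \int[area R]_(z in D) (g z)%:E)%E ->
  ((a `^ p)%:E <= (2 * C * (2 * C * V) `^ (p - 1))%:E *
     \int[area R]_(z in D) (g z `^ p)%:E)%E.
Proof.
move=> p1 C0 V0 a0 cg g0 mD DV H.
have p0 : 0 < p by exact: lt_le_trans p1.
set J := (\int[area R]_(z in D) (g z `^ p)%:E)%E.
have J0 : (0 <= J)%E by apply: integral_ge0 => z _; rewrite lee_fin powR_ge0.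
have K0 : 0 < 2 * C * (2 * C * V) `^ (p - 1).
  by rewrite mulr_gt0 // ?powR_gt0 // ?mulr_gt0.
have [->|an0] := eqVneq a 0.
  by rewrite powR0 ?gt_eqF // mule_ge0 // lee_fin ltW.
have ap : 0 < a by rewrite lt0r an0.
pose l := a / (2 * C * V).
have l0 : 0 < l by rewrite divr_gt0 // !mulr_gt0.
have lp : 0 < l `^ (p - 1) by exact: powR_gt0.
have mg : measurable_fun D (g : plane R -> measurableTypeR R).
  exact: measurable_funS (continuous_plane_measurable cg).
have mgp : measurable_fun D (fun z : plane R => ((g z `^ p)%:E)).
  apply/measurable_EFinP; exact: (measurableT_comp (measurable_powR p) mg).
have H1 : (\int[area R]_(z in D) (g z)%:E <= l%:E * V%:E + (l `^ (p - 1))^-1%:E * J)%E.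
  apply: (@le_trans _ _ (\int[area R]_(z in D) (cst l%:E z + (l `^ (p - 1))^-1%:E * (g z `^ p)%:E))%E).
    apply: ge0_le_integral => //.
    - by move=> z _; rewrite lee_fin.
    - exact/measurable_EFinP.
    - by apply: emeasurable_funD => //; exact: measurable_funeM.
    - by move=> z _; rewrite /= -EFinM -EFinD lee_fin [_^-1 * _]mulrC le_young.
  rewrite ge0_integralD //.
  - rewrite integral_cst //= ge0_integralZl //.
    + by rewrite leeD2r // lee_wpmul2l // lee_fin ltW.
    + by move=> z _; rewrite lee_fin powR_ge0.
    + by rewrite lee_fin invr_ge0 ltW.
  - by move=> z _; rewrite lee_fin ltW.
  - by move=> z _; rewrite -EFinM lee_fin mulr_ge0 // ?invr_ge0 ?powR_ge0.
  - exact: measurable_funeM.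
have {H H1} : (a%:E <= C%:E * (l%:E * V%:E + (l `^ (p - 1))^-1%:E * J))%E.
  by apply: (le_trans H); rewrite lee_wpmul2l // lee_fin ltW.
case: J J0 => [j| |] //; last first.
  by move=> _ _; rewrite gt0_muley ?lte_fin // leey.
rewrite lee_fin => j0; rewrite -!EFinM !lee_fin => H.
have E1 : C * (l * V) = a / 2 by rewrite /l; field; rewrite !gt_eqF.
(* [a = 2 C V l] splits off the power of [l] that cancels the one in Young's
   inequality. *)
have E2 : a `^ p = a * ((2 * C * V) `^ (p - 1) * l `^ (p - 1)).
  rewrite -powRM; [|by rewrite !mulr_ge0 // ltW|exact: ltW].
  have -> : 2 * C * V * l = a by rewrite /l; field; rewrite !gt_eqF.
  rewrite -{2}(powRr1 a0) -powRD; last by rewrite (gt_eqF ap) implybT.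
  by rewrite addrC subrK.
have H2 : a <= 2 * C * (j / l `^ (p - 1)) by move: H; rewrite mulrDr E1 [_^-1 * _]mulrC; lra.
rewrite E2; set q := (2 * C * V) `^ (p - 1).
have q0 : 0 <= q * l `^ (p - 1) by rewrite mulr_ge0 // powR_ge0.
apply: (le_trans (ler_wpM2r q0 H2)).
rewrite le_eqVlt; apply/orP; left; apply/eqP; field; rewrite gt_eqF //.
Qed.

Lemma normc_sqrt (x : R[i]) :
  ComplexField.Normc.normc x = Num.sqrt (complex.Re x ^+ 2 + complex.Im x ^+ 2).
Proof. by case: x. Qed.

Lemma weighted_powE (al p : R) (f : R * R -> R[i]) w :
  weighted_pow al p f w =
  ((Num.sqrt (complex.Re (f w) ^+ 2 + complex.Im (f w) ^+ 2) * gauss_weight al w) `^ p)%:E.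
Proof.
rewrite /weighted_pow; congr ((_ `^ p)%:E).
have -> : expR (- (al * ComplexField.Normc.normc (cplx w) ^+ 2 / 2)) = gauss_weight al w.
  rewrite normc_sqrt /= sqr_sqrtr ?addr_ge0 ?sqr_ge0 // /gauss_weight; congr expR; by field.
have w0 : 0 <= gauss_weight al w by exact: expR_ge0.
case: (f w) => a b; rewrite normc_sqrt /= !mulr0 subr0 add0r.
rewrite !exprMn -mulrDl sqrtrM ?addr_ge0 ?sqr_ge0 // sqrtr_sqr ger0_norm //.
Qed.

Lemma cont_sqrtsum (u v : R * R -> R) : continuous u -> continuous v ->
  continuous (fun z => Num.sqrt (u z ^+ 2 + v z ^+ 2)).
Proof.
move=> cu cv.
exact (cont_comp (@sqrt_continuous R) (contD2 (contM2 cu cu) (contM2 cv cv))).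
Qed.

Lemma real_harmonic_continuous (u : R * R -> R) : real_harmonic u -> continuous u.
Proof. by move=> /real_harmonicE[ux [uy [_ [_ [_ [gu _ _ _]]]]]]; exact (gradc_continuous gu). Qed.

Lemma norm_le_sqrt (a b : R) : `|a| <= Num.sqrt (a ^+ 2 + b ^+ 2).
Proof. by rewrite -sqrtr_sqr ler_wsqrtr // lerDl sqr_ge0. Qed.

Lemma sqrt_le_norm (a b : R) : Num.sqrt (a ^+ 2 + b ^+ 2) <= `|a| + `|b|.
Proof.
rewrite -[leRHS]ger0_norm ?addr_ge0 // -sqrtr_sqr ler_wsqrtr //.
rewrite sqrrD !real_normK ?num_real // lerD2r lerDl mulrn_wge0 // mulr_ge0 //.
Qed.

Theorem harmonic_power_average (al r p : R) : 0 < al -> 0 < r -> 1 <= p ->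
  exists2 C : R, 0 < C & forall f, complex_harmonic f -> forall w,
    (weighted_pow al p f w <=
     C%:E * \int[area R]_(z in open_disc w r) weighted_pow al p f z)%E.
Proof.
move=> al0 r0 p1; have [C C0 H] := harmonic_pointwise al0 r0.
exists (2 * (2 * C) * (2 * (2 * C) * (4 * r ^+ 2)) `^ (p - 1)).
  by rewrite mulr_gt0 // ?powR_gt0 // !mulr_gt0 // exprn_gt0.
move=> f [hu hv] w.
have cu := real_harmonic_continuous hu; have cv := real_harmonic_continuous hv.
set u := (fun z => complex.Re (f z)) in hu cu.
set v := (fun z => complex.Im (f z)) in hv cv.
pose g z := Num.sqrt (u z ^+ 2 + v z ^+ 2) * gauss_weight al z.
have cg : continuous g by exact (contM2 (cont_sqrtsum cu cv) (@cont_gauss_weight R al)).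
have g0 z : 0 <= g z by rewrite mulr_ge0 ?sqrtr_ge0 ?expR_ge0.
have -> : (\int[area R]_(z in open_disc w r) weighted_pow al p f z
   = \int[area R]_(z in open_disc w r) (g z `^ p)%:E)%E.
  by apply: eq_integral => z _; rewrite weighted_powE.
rewrite weighted_powE -/(g w).
have r20 : 0 < 4 * r ^+ 2 by rewrite mulr_gt0 // exprn_gt0.
apply: average_powR => //.
- by rewrite mulr_gt0.
- exact: open_disc_measurable.
- exact: area_open_disc_le.
have ig := cont_integrable_disc w cg r0.
have -> : (\int[area R]_(z in open_disc w r) (g z)%:E
   = (\int[area R]_(z in open_disc w r) g z)%:E)%E.
  by rewrite /Rintegral fineK //; exact: (integrable_fin_num (@open_disc_measurable R w r) ig).
rewrite -EFinM lee_fin.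
have D (h : R * R -> R) : continuous h -> (forall z, `|h z| * gauss_weight al z <= g z) ->
    \int[area R]_(z in open_disc w r) (`|h z| * gauss_weight al z) <= \int[area R]_(z in open_disc w r) g z.
  move=> ch hg; apply: le_Rintegral => //.
  - exact: open_disc_measurable.
  - exact: cont_integrable_disc (cont_norm_gauss_weight ch) r0.
have Du := D u cu (fun z => ler_wpM2r (expR_ge0 _) (norm_le_sqrt (u z) (v z))).
have Dv : \int[area R]_(z in open_disc w r) (`|v z| * gauss_weight al z) <= \int[area R]_(z in open_disc w r) g z.
  apply: D => // z; apply: (ler_wpM2r (expR_ge0 _)).
  by rewrite [X in Num.sqrt X]addrC norm_le_sqrt.
apply: (@le_trans _ _ (`|u w| * gauss_weight al w + `|v w| * gauss_weight al w)).
  by rewrite -mulrDl ler_wpM2r ?expR_ge0 // sqrt_le_norm.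
have := H u hu w; have := H v hv w.
have := ler_wpM2l (ltW C0) Du; have := ler_wpM2l (ltW C0) Dv.
lra.
Qed.

Lemma measurable_weighted_pow (al p : R) (f : R * R -> R[i]) :
  complex_harmonic f ->
  measurable_fun setT (weighted_pow al p f : plane R -> \bar R).
Proof.
move=> [hu hv].
have cu := real_harmonic_continuous hu; have cv := real_harmonic_continuous hv.
have cg := contM2 (cont_sqrtsum cu cv) (@cont_gauss_weight R al).
have -> : weighted_pow al p f = EFin \o ((fun x => x `^ p) \o
   (fun z => Num.sqrt (complex.Re (f z) ^+ 2 + complex.Im (f z) ^+ 2) * gauss_weight al z)).
  by apply/funext => z; rewrite weighted_powE.
apply/measurable_EFinP.
exact: (measurableT_comp (measurable_powR p) (continuous_plane_measurable cg)).
Qed.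

Lemma weighted_pow_ge0 (al p : R) (f : R * R -> R[i]) w : (0 <= weighted_pow al p f w)%E.
Proof. by rewrite /weighted_pow lee_fin powR_ge0. Qed.

(** The discs of the statement are described by the modulus of complex numbers,
    those of the proof by the squared distance, which is polynomial. *)
Lemma discE (z : R * R) r : 0 < r -> disc z r = open_disc z r.
Proof.
move=> r0.
have E w : ComplexField.Normc.normc (cplx w - cplx z) = Num.sqrt (sqdist w z).
  by rewrite normc_sqrt.
apply/seteqP; split => w; rewrite /disc /open_disc /mkset E => h.
  by rewrite -[ltLHS](sqr_sqrtr (sqdist_ge0 w z)) ltr_sqr ?nnegrE ?sqrtr_ge0 // ltW.
by rewrite -(gtr0_norm r0) -sqrtr_sqr ltr_sqrt // exprn_gt0.
Qed.

Theorem carleson_embedding (al r p : R) (mu : {measure set (plane R) -> \bar R}) :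
  0 < al -> 0 < r -> 1 <= p ->
  (exists C : R, forall z, (mu (disc z r) <= C%:E)%E) ->
  exists C : R, 0 < C /\ forall f, complex_harmonic f ->
    (\int[mu]_w weighted_pow al p f w
     <= C%:E * \int[area R]_w weighted_pow al p f w)%E.
Proof.
move=> al0 r0 p1 [C1 muC].
have {}muC z : (mu (open_disc z r) <= (Num.max 1 C1)%:E)%E.
  by rewrite -discE // (le_trans (muC z)) // lee_fin le_max lexx orbT.
have [C C0 H] := harmonic_power_average al0 r0 p1.
have m0 : 0 < Num.max 1 C1 by rewrite lt_max ltr01.
exists (C * Num.max 1 C1); split; first by rewrite mulr_gt0.
move=> f hf.
have mf := measurable_weighted_pow al p hf.
pose W (w : plane R) := (\int[area R]_(z in open_disc w r) weighted_pow al p f z)%E.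
have mW : measurable_fun setT W.
  exact: measurable_disc_integral mf (weighted_pow_ge0 _ _ _).
apply: (@le_trans _ _ (\int[mu]_w (C%:E * W w))%E).
  apply: ge0_le_integral => //.
  - by move=> w _; exact: weighted_pow_ge0.
  - exact: measurable_funeM.
  - by move=> w _; exact: H.
have W0 w : (0 <= W w)%E by apply: integral_ge0 => z _; exact: weighted_pow_ge0.
rewrite ge0_integralZl //; last by rewrite lee_fin ltW.
rewrite EFinM -muleA lee_wpmul2l ?lee_fin ?(ltW C0) //.
exact: tonelli_discs r0 muC mf (weighted_pow_ge0 _ _ _).
Qed.

End powers.

(** * Kernel functions and Gaussian integrals *)

Section kernel_functions.
Context {R : realType}.
Implicit Types (u v : R * R -> R) (z w : R * R).

Lemma pdx_derivable u ux : pdx u ux ->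
  (forall z, derivable u z (1, 0)) /\ partial_x u = ux.
Proof.
move=> du.
have E x y : (fun h : R => h^-1 *: (u (h *: ((1 : R), (0 : R)) + (x, y)) - u (x, y)))
  = (fun h => h^-1 *: ((fun t => u (t, y)) (h *: 1 + x) - u (x, y))).
  apply/funext => h; congr (_ *: (u _ - _)).
  by apply: injective_projections; rewrite /= ?scaler0 ?add0r.
split.
  move=> [x y]; rewrite /derivable E.
  have d := du x y; exact (@ex_derive _ _ _ _ _ _ _ d).
apply/funext => -[x y]; rewrite /partial_x /derive E.
have d := du x y; exact (@derive_val _ _ _ _ _ _ _ d).
Qed.

Lemma pdy_derivable u uy : pdy u uy ->
  (forall z, derivable u z (0, 1)) /\ partial_y u = uy.
Proof.
move=> du.
have E x y : (fun h : R => h^-1 *: (u (h *: ((0 : R), (1 : R)) + (x, y)) - u (x, y)))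
  = (fun h => h^-1 *: ((fun t => u (x, t)) (h *: 1 + y) - u (x, y))).
  apply/funext => h; congr (_ *: (u _ - _)).
  by apply: injective_projections; rewrite /= ?scaler0 ?add0r.
split.
  move=> [x y]; rewrite /derivable E.
  have d := du x y; exact (@ex_derive _ _ _ _ _ _ _ d).
apply/funext => -[x y]; rewrite /partial_y /derive E.
have d := du x y; exact (@derive_val _ _ _ _ _ _ _ d).
Qed.

Lemma gradc_C1 u ux uy : gradc u ux uy ->
  [/\ C1 u, partial_x u = ux & partial_y u = uy].
Proof.
case=> dx dy cx cy.
have [dx' ex] := pdx_derivable dx; have [dy' ey] := pdy_derivable dy.
split; [|exact ex|exact ey].
apply: And4; [exact dx'|exact dy'|rewrite ex; exact cx|rewrite ey; exact cy].
Qed.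

(** The two conditions say that the linear parts of [A] and [B] are orthogonal
    and of equal length, that is, that [A + i B] or its conjugate is
    holomorphic. *)
Lemma expcos_harmonic (p q k s t l c1 c2 : R) :
  p * s + q * t = 0 -> p ^+ 2 + q ^+ 2 = s ^+ 2 + t ^+ 2 ->
  real_harmonic (expcos p q k s t l c1 c2).
Proof.
move=> H1 H2.
have [a1 a2 a3] := gradc_C1 (gradc_expcos p q k s t l c1 c2).
rewrite /real_harmonic a2 a3.
have [b1 b2 _] := gradc_C1 (gradc_expcos p q k s t l (p * c1 + s * c2) (p * c2 - s * c1)).
have [d1 _ d3] := gradc_C1 (gradc_expcos p q k s t l (q * c1 + t * c2) (q * c2 - t * c1)).
rewrite b2 d3; apply: And4; [exact a1|exact b1|exact d1|] => z.
rewrite /expcos; set e := expR _; set C := cos _; set S := sin _.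
transitivity (e * (((p ^+ 2 + q ^+ 2 - (s ^+ 2 + t ^+ 2)) * c1
    + 2 * (p * s + q * t) * c2) * C
  + ((p ^+ 2 + q ^+ 2 - (s ^+ 2 + t ^+ 2)) * c2
    - 2 * (p * s + q * t) * c1) * S)).
  rewrite /expcos -/e -/C -/S; ring.
by rewrite H1 H2 subrr !(mulr0, mul0r, subr0, addr0).
Qed.

(** [phase] and [lexp] are the argument of [k_z w] and the logarithm of its
    modulus. *)
Definition phase (al : R) (z w : R * R) : R := al * (z.1 * w.2 - z.2 * w.1).
Definition lexp (al : R) (z w : R * R) : R :=
  al * (z.1 * w.1 + z.2 * w.2) - al / 2 * (z.1 ^+ 2 + z.2 ^+ 2).

Lemma kzE al z w : kz al z w =
  Complex (expR (lexp al z w) * cos (phase al z w))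
    (expR (lexp al z w) * sin (phase al z w)).
Proof.
rewrite /kz; case: z => a b; case: w => x y.
rewrite /cexp normc_sqrt /lexp /phase /= sqr_sqrtr ?addr_ge0 ?sqr_ge0 //.
have -> : (al * a - 0 * - b) * x - (al * - b + 0 * a) * y - al / 2 * (a ^+ 2 + b ^+ 2)
  = al * (a * x + b * y) - al / 2 * (a ^+ 2 + b ^+ 2) by ring.
have -> : (al * a - 0 * - b) * y + (al * - b + 0 * a) * x - 0 = al * (a * y - b * x) by ring.
set e := expR _; set c := cos _; set s := sin _.
apply/eqP; rewrite eq_complex /= !mul0r subr0 addr0.
by rewrite !eqxx.
Qed.

Lemma kz_harmonic al z : complex_harmonic (kz al z).
Proof.
have E c1 c2 w : expcos (al * z.1) (al * z.2) (- (al / 2 * (z.1 ^+ 2 + z.2 ^+ 2)))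
   (- (al * z.2)) (al * z.1) 0 c1 c2 w =
   expR (lexp al z w) * (c1 * cos (phase al z w) + c2 * sin (phase al z w)).
  rewrite /expcos /affine /lexp /phase.
  by congr (expR _ * (_ * cos _ + _ * sin _)); ring.
split.
  rewrite (_ : (fun w => _) = expcos (al * z.1) (al * z.2) (- (al / 2 * (z.1 ^+ 2 + z.2 ^+ 2)))
   (- (al * z.2)) (al * z.1) 0 1 0); first by apply: expcos_harmonic; ring.
  by apply/funext => w; rewrite E kzE /= mul1r mul0r addr0.
rewrite (_ : (fun w => _) = expcos (al * z.1) (al * z.2) (- (al / 2 * (z.1 ^+ 2 + z.2 ^+ 2)))
   (- (al * z.2)) (al * z.1) 0 0 1); first by apply: expcos_harmonic; ring.
by apply/funext => w; rewrite E kzE /= mul1r mul0r add0r.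
Qed.

Lemma weighted_pow_kz al p z w : weighted_pow al p (kz al z) w =
  (expR (- (p * al / 2 * sqdist w z)))%:E.
Proof.
rewrite weighted_powE kzE /=; congr EFin.
rewrite !exprMn -mulrDr cos2Dsin2 mulr1 sqrtr_sqr ger0_norm ?expR_ge0 // /gauss_weight -expRD.
rewrite /powR gt_eqF ?expR_gt0 // expRK; congr expR; rewrite /lexp /sqdist; by field.
Qed.

Lemma hz_sqr al z (u : R * R) :
  ComplexField.Normc.normc (hz al z u) ^+ 2 *
    expR (- (al * ComplexField.Normc.normc (cplx u) ^+ 2)) =
  2 * expR (- (al * sqdist u z)) * cos (phase al z u) ^+ 2.
Proof.
rewrite /hz kzE !normc_sqrt /= !sqr_sqrtr ?addr_ge0 ?sqr_ge0 //.
rewrite ?(mul0r, mulr0, subr0, addr0, add0r, sub0r, oppr0).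
set e := expR (lexp al z u); set c := cos _; set s := sin _.
have -> : expR (- (al * sqdist u z)) = e ^+ 2 * expR (- (al * (u.1 ^+ 2 + u.2 ^+ 2))).
  rewrite /e expr2 -!expRD; congr expR; rewrite /lexp /sqdist; by field.
rewrite subrr mulr0 expr0n /= addr0.
have s2 : Num.sqrt 2 ^+ 2 = 2 :> R by rewrite sqr_sqrtr.
have -> : (Num.sqrt 2 / 2 * (e * c + e * c)) ^+ 2 = Num.sqrt 2 ^+ 2 * (e ^+ 2 * c ^+ 2) by field.
rewrite s2; ring.
Qed.

Lemma measurable_gauss (b m : R) :
  measurable_fun setT (fun x : measurableTypeR R => (expR (- (b * (x - m) ^+ 2)))%:E).
Proof.
apply/measurable_EFinP; apply: (measurableT_comp (@measurable_expR R)).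
apply: measurableT_comp => //; apply: measurable_funM => //.
by apply: measurable_funX; exact: measurable_funB.
Qed.

(** The value is the inverse of the peak of a normal density, whose total mass
    does not depend on its mean. *)
Lemma gauss1 (b : R) : 0 < b -> exists2 K : R, 0 < K & forall m : R,
  (\int[lebesgue_measure]_x (expR (- (b * (x - m) ^+ 2)))%:E = K%:E)%E.
Proof.
move=> b0.
pose s := (Num.sqrt (2 * b))^-1.
have b20 : 0 < 2 * b by rewrite mulr_gt0.
have sb0 : 0 < Num.sqrt (2 * b) by rewrite sqrtr_gt0.
have s0 : s != 0 by rewrite invr_neq0 // gt_eqF.
have s2 : s ^+ 2 = (2 * b)^-1 by rewrite exprVn sqr_sqrtr // ltW.
have pk := normal_peak_gt0 s0.
exists (normal_peak s)^-1; first by rewrite invr_gt0.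
move=> m.
have E x : expR (- (b * (x - m) ^+ 2)) = (normal_peak s)^-1 * normal_pdf m s x.
  rewrite normal_pdfE //= mulrA mulVf ?gt_eqF // mul1r /normal_fun s2.
  congr expR; rewrite -mulr_natr; field; by rewrite gt_eqF.
under eq_integral do rewrite E EFinM.
rewrite ge0_integralZl //.
- by rewrite integral_normal_pdf // mule1.
- by apply/measurable_EFinP; exact: measurable_normal_pdf.
- by move=> x _; rewrite lee_fin normal_pdf_ge0.
- by rewrite lee_fin invr_ge0 ltW.
Qed.

Lemma cont_gauss (b : R) z : continuous (fun w => expR (- (b * sqdist w z))).
Proof.
exact (cont_comp (@continuous_expR R) (contN2 (contM2 (@cont_cst R b) (@cont_sqdist R z)))).
Qed.

Lemma gauss2 (b : R) : 0 < b -> exists2 K : R, 0 < K & forall z,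
  (\int[area R]_w (expR (- (b * sqdist w z)))%:E = K%:E)%E.
Proof.
move=> b0; have [K K0 H] := gauss1 b0; exists (K * K); first by rewrite mulr_gt0.
move=> z.
have mf : measurable_fun setT (fun w : plane R => (expR (- (b * sqdist w z)))%:E).
  by apply/measurable_EFinP; exact: (continuous_plane_measurable (@cont_gauss b z)).
have := fubini_tonelli1 (m1 := @lebesgue_measure R) (m2 := @lebesgue_measure R) _ mf
  (fun w => expR_ge0 _).
rewrite /fubini_F => E; rewrite [LHS]E.
have F (x : R) : (\int[lebesgue_measure]_y (expR (- (b * sqdist (x, y) z)))%:E
   = K%:E * (expR (- (b * (x - z.1) ^+ 2)))%:E)%E.
  rewrite -(H z.2) muleC -ge0_integralZl //.
  - apply: eq_integral => y _; rewrite -EFinM -expRD /sqdist /=.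
    congr (EFin (expR _)); ring.
  - exact: measurable_gauss.
under eq_integral do rewrite F.
rewrite ge0_integralZl //; first by rewrite H EFinM.
- exact: measurable_gauss.
- by rewrite lee_fin ltW.
Qed.

End kernel_functions.

(** * Recovering disc masses *)

Section equivalence.
Context {R : realType}.
Implicit Types (u v : R * R -> R) (z w : R * R).

Implicit Types mu : {measure set (plane R) -> \bar R}.

(** Test functions [k_z]: the weighted powers are translates of one Gaussian. *)
Lemma gaussian_mass_of_embedding mu (al p : R) : 0 < al -> 1 <= p ->
  (exists C : R, 0 < C /\ forall f, harmonic_fock al p f ->
    (\int[mu]_w weighted_pow al p f w
     <= C%:E * \int[area R]_w weighted_pow al p f w)%E) ->
  exists K : R, forall z, (\int[mu]_w (expR (- (p * al / 2 * sqdist w z)))%:E <= K%:E)%E.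
Proof.
move=> al0 p1 [C [C0 H]].
have b0 : 0 < p * al / 2 by rewrite divr_gt0 // mulr_gt0 // (lt_le_trans ltr01).
have [K K0 G] := gauss2 b0.
exists (C * K) => z.
have E (m : {measure set (plane R) -> \bar R}) : (\int[m]_w weighted_pow al p (kz al z) w =
    \int[m]_w (expR (- (p * al / 2 * sqdist w z)))%:E)%E.
  by apply: eq_integral => w _; exact: weighted_pow_kz.
have := H (kz al z); rewrite !E G -EFinM; apply.
by split; [exact: kz_harmonic|rewrite E G ltry].
Qed.

Lemma markov_disc mu (f : R * R -> R) (D : set (plane R)) (c M : R) :
  continuous f -> (forall w, 0 <= f w) -> measurable D -> 0 < c ->
  (forall w, D w -> c <= f w) -> (\int[mu]_w (f w)%:E <= M%:E)%E ->
  (mu D <= (M / c)%:E)%E.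
Proof.
move=> cf f0 mD c0 cfD fM.
have mf : measurable_fun setT (fun w : plane R => (f w)%:E).
  by apply/measurable_EFinP; exact: continuous_plane_measurable.
rewrite EFinM muleC lee_pdivlMl //.
apply: le_trans fM; apply: (@le_trans _ _ (\int[mu]_(w in D) (f w)%:E)%E).
  rewrite -(integral_cst mu mD c%:E); apply: ge0_le_integral => //.
  - by move=> w _; rewrite lee_fin ltW.
  - exact: measurable_funS mf.
apply: ge0_subset_integral => //.
by move=> w _; rewrite lee_fin.
Qed.

Lemma disc_mass_of_gaussian_mass mu (b r : R) : 0 < b -> 0 < r ->
  (exists K : R, forall z, (\int[mu]_w (expR (- (b * sqdist w z)))%:E <= K%:E)%E) ->
  exists C : R, forall z, (mu (disc z r) <= C%:E)%E.
Proof.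
move=> b0 r0 [K H]; exists (K / expR (- (b * r ^+ 2))) => z; rewrite discE //.
apply: (markov_disc (@cont_gauss R b z)).
- by move=> w; exact: expR_ge0.
- exact: open_disc_measurable.
- exact: expR_gt0.
- by move=> w; rewrite /open_disc /= => /ltW h; rewrite ler_expR lerN2 ler_pM2l.
- exact: H.
Qed.

Lemma berezin_integrand_ge0 (al : R) (z w : R * R) :
  0 <= 2 * expR (- (al * sqdist w z)) * cos (phase al z w) ^+ 2.
Proof. exact: mulr_ge0 (mulr_ge0 (ler0n _ _) (expR_ge0 _)) (sqr_ge0 _). Qed.

Lemma berezinE mu al z : berezin al mu z =
  (\int[mu]_u (2 * expR (- (al * sqdist u z)) * cos (phase al z u) ^+ 2)%:E)%E.
Proof. by apply: eq_integral => u0 _; rewrite hz_sqr. Qed.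

Lemma cont_phase al z : continuous (phase al z).
Proof.
exact (contM2 (@cont_cst R al) (contD2 (contM2 (@cont_cst R z.1) (@cont_snd R))
  (contN2 (contM2 (@cont_cst R z.2) (@cont_fst R))))).
Qed.

Lemma cont_berezin al z :
  continuous (fun w => 2 * expR (- (al * sqdist w z)) * cos (phase al z w) ^+ 2).
Proof.
have cc := cont_comp (@continuous_cos R) (@cont_phase al z).
exact (contM2 (contM2 (@cont_cst R 2) (@cont_gauss R al z)) (contM2 cc cc)).
Qed.

Lemma berezin_le_gaussian mu al z :
  (berezin al mu z <= 2%:E * \int[mu]_w (expR (- (al * sqdist w z)))%:E)%E.
Proof.
have mg : measurable_fun setT (fun w : plane R => (expR (- (al * sqdist w z)))%:E).
  by apply/measurable_EFinP; exact: (continuous_plane_measurable (@cont_gauss R al z)).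
rewrite berezinE -ge0_integralZl //.
apply: ge0_le_integral => //.
- by move=> w _; rewrite lee_fin berezin_integrand_ge0.
- by apply/measurable_EFinP; exact: (continuous_plane_measurable (@cont_berezin al z)).
- exact: measurable_funeM.
by move=> w _; rewrite -EFinM lee_fin ler_piMr ?mulr_ge0 ?expR_ge0 //.
Qed.

Lemma norm_sin_le (x : R) : `|sin x| <= `|x|.
Proof.
have [c _] := MVT_sym 0 x (fun y => @is_derive_sin R y).
rewrite add0r sin0 subr0 => ->; rewrite normrM ler_piMl //.
by rewrite ler_norml cos_geN1 cos_le1.
Qed.

(** The sum is [1 - sin e * sin (x + y)] with [y = x - e], so it stays above
    one half as long as the shift is close to a quarter period. *)
Lemma cos2_quarter_shift (x e : R) : `|e| <= 1 / 2 ->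
  1 / 2 <= cos x ^+ 2 + cos (x - pi / 2 - e) ^+ 2.
Proof.
move=> e2; have se : `|sin e| <= 1 / 2 := le_trans (norm_sin_le e) e2.
have -> : cos (x - pi / 2 - e) = sin (x - e).
  rewrite (_ : x - pi / 2 - e = (x - e) - pi / 2); last by ring.
  by rewrite cosB cos_pihalf sin_pihalf mulr0 add0r mulr1.
set y := x - e.
have X : cos x ^+ 2 = 1 - sin x ^+ 2 by rewrite -(cos2Dsin2 x) addrK.
have Y : cos y ^+ 2 = 1 - sin y ^+ 2 by rewrite -(cos2Dsin2 y) addrK.
have P : sin (x - y) * sin (x + y) = sin x ^+ 2 - sin y ^+ 2.
  rewrite sinB sinD.
  transitivity (sin x ^+ 2 * cos y ^+ 2 - cos x ^+ 2 * sin y ^+ 2); first by ring.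
  by rewrite X Y; ring.
have -> : cos x ^+ 2 + sin y ^+ 2 = 1 - sin (x - y) * sin (x + y).
  by rewrite P X; ring.
have -> : x - y = e by rewrite /y; ring.
have : `|sin e * sin (x + y)| <= 1 / 2.
  rewrite normrM (le_trans _ se) // ler_piMr //.
  by rewrite ler_norml sin_geN1 sin_le1.
rewrite ler_norml; lra.
Qed.

(** Near the origin the transform at 0 has a positive integrand. Far from it,
    two centres [z] and [z'] are used whose phases differ by about a quarter
    period on the whole disc. *)
Lemma disc_mass_of_berezin mu (al r : R) : 0 < al -> 0 < r ->
  (exists M : R, forall z, (berezin al mu z <= M%:E)%E) ->
  exists C : R, forall z, (mu (disc z r) <= C%:E)%E.
Proof.
move=> al0 r0 [M HM].
have M0 : 0 <= M.
  rewrite -lee_fin; apply: le_trans (HM (0, 0)); rewrite berezinE.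
  apply: integral_ge0 => w _; rewrite lee_fin.
  exact: berezin_integrand_ge0.
have pi0 : 0 < pi :> R by exact: pi_gt0.
have pr0 : 0 < (pi * r) ^+ 2 by rewrite exprn_gt0 // mulr_gt0.
(* [T0] and [T1] bound the squared distances in the Gaussian factors; beyond
   [pi * r] from the origin the error of the phase shift is at most 1/2. *)
pose T0 := 2 * (pi * r) ^+ 2 + 2 * r ^+ 2.
pose c := pi / (2 * al).
have c0 : 0 < c by rewrite divr_gt0 // mulr_gt0.
pose T1 := 2 * r ^+ 2 + 2 * (c ^+ 2 / (pi * r) ^+ 2).
pose C0 := M / (2 * expR (- (al * T0))).
pose C1 := 2 * M / expR (- (al * T1)).
have C00 : 0 <= C0 by rewrite divr_ge0 // mulr_ge0 // expR_ge0.
have C10 : 0 <= C1 by rewrite divr_ge0 // ?mulr_ge0 // expR_ge0.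
exists (C0 + C1) => z; rewrite discE //.
have r2 : 0 < r ^+ 2 by rewrite exprn_gt0.
pose n := z.1 ^+ 2 + z.2 ^+ 2.
have [zs|zl] := leP n ((pi * r) ^+ 2).
  apply: (@le_trans _ _ C0%:E); last by rewrite lee_fin lerDl.
  apply: (markov_disc (@cont_berezin al (0, 0))).
  - by move=> w; exact: berezin_integrand_ge0.
  - exact: open_disc_measurable.
  - by rewrite mulr_gt0 // expR_gt0.
  - move=> w; rewrite /open_disc /= => wz.
    have -> : phase al (0, 0) w = 0 by rewrite /phase /= !mul0r subrr mulr0.
    rewrite cos0 expr1n mulr1 ler_pM2l // ler_expR lerN2 ler_pM2l //.
    rewrite /T0 /sqdist /= !subr0; move: wz zs; rewrite /sqdist /n => wz zs.
    have q1 := sqr_ge0 (w.1 - 2 * z.1); have q2 := sqr_ge0 (w.2 - 2 * z.2).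
    have E1 : w.1 ^+ 2 = 2 * (w.1 - z.1) ^+ 2 + 2 * z.1 ^+ 2 - (w.1 - 2 * z.1) ^+ 2 by ring.
    have E2 : w.2 ^+ 2 = 2 * (w.2 - z.2) ^+ 2 + 2 * z.2 ^+ 2 - (w.2 - 2 * z.2) ^+ 2 by ring.
    rewrite E1 E2; lra.
  - by rewrite -berezinE.
apply: (@le_trans _ _ C1%:E); last by rewrite lee_fin lerDr.
have n0 : 0 < n by exact: lt_trans zl.
pose z' : R * R := (z.1 - c / n * z.2, z.2 + c / n * z.1).
apply: (markov_disc (contD2 (@cont_berezin al z) (@cont_berezin al z'))).
- by move=> w; apply: addr_ge0; exact: berezin_integrand_ge0.
- exact: open_disc_measurable.
- exact: expR_gt0.
- move=> w; rewrite /open_disc /= => wz.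
  pose e := pi / 2 * (z.1 * (w.1 - z.1) + z.2 * (w.2 - z.2)) / n.
  have -> : phase al z' w = phase al z w - pi / 2 - e.
    have nn : z.1 ^+ 2 + z.2 ^+ 2 != 0 by rewrite gt_eqF.
    rewrite /phase /e /z' /c /n /=; field; by rewrite nn gt_eqF.
  have e2 : `|e| <= 1 / 2.
    have cs : (z.1 * (w.1 - z.1) + z.2 * (w.2 - z.2)) ^+ 2 <= n * r ^+ 2.
      have q := sqr_ge0 (z.1 * (w.2 - z.2) - z.2 * (w.1 - z.1)).
      have q2 : n * sqdist w z <= n * r ^+ 2 by rewrite ler_pM2l // ltW.
      have q3 : n * sqdist w z = (z.1 * (w.1 - z.1) + z.2 * (w.2 - z.2)) ^+ 2
        + (z.1 * (w.2 - z.2) - z.2 * (w.1 - z.1)) ^+ 2 by rewrite /n /sqdist; ring.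
      lra.
    have e4 : e ^+ 2 <= (1 / 2) ^+ 2.
      have -> : e ^+ 2 = (pi ^+ 2 / 4) * ((z.1 * (w.1 - z.1) + z.2 * (w.2 - z.2)) ^+ 2 / n ^+ 2).
        by rewrite /e; field; rewrite gt_eqF.
      apply: (@le_trans _ _ ((pi ^+ 2 / 4) * (n * r ^+ 2 / n ^+ 2))).
        rewrite ler_wpM2l ?divr_ge0 ?sqr_ge0 // ler_wpM2r // invr_ge0 sqr_ge0 //.
      have -> : pi ^+ 2 / 4 * (n * r ^+ 2 / n ^+ 2) = ((pi * r) ^+ 2 / n) / 4.
        by field; rewrite gt_eqF.
      have : (pi * r) ^+ 2 / n <= 1 by rewrite ler_pdivrMr // mul1r ltW.
      have -> : (1 / 2) ^+ 2 = 1 / 4 :> R by field.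
      lra.
    move: e4; rewrite -(real_normK (num_real e)) ler_sqr ?nnegrE // divr_ge0 //.
  have H := cos2_quarter_shift (phase al z w) e2.
  have T1r : r ^+ 2 <= T1.
    have : 0 <= c ^+ 2 / (pi * r) ^+ 2 by rewrite divr_ge0 // ?sqr_ge0.
    by rewrite /T1; lra.
  have g1 : expR (- (al * T1)) <= expR (- (al * sqdist w z)).
    by rewrite ler_expR lerN2 ler_pM2l // (le_trans (ltW wz)).
  have g2 : expR (- (al * T1)) <= expR (- (al * sqdist w z')).
    rewrite ler_expR lerN2 ler_pM2l // /T1.
    have q1 := sqr_ge0 ((w.1 - z.1) - c / n * z.2).
    have q2 := sqr_ge0 ((w.2 - z.2) + c / n * z.1).
    have E : sqdist w z' = 2 * sqdist w z + 2 * (c ^+ 2 / n)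
       - ((w.1 - z.1) - c / n * z.2) ^+ 2 - ((w.2 - z.2) + c / n * z.1) ^+ 2.
      have nn : z.1 ^+ 2 + z.2 ^+ 2 != 0 by rewrite gt_eqF.
      by rewrite /sqdist /z' /n /=; field.
    have : c ^+ 2 / n <= c ^+ 2 / (pi * r) ^+ 2.
      by rewrite ler_wpM2l ?sqr_ge0 // lef_pV2 ?posrE // ltW.
    rewrite E; lra.
  have s1 := sqr_ge0 (cos (phase al z w)).
  have s2 := sqr_ge0 (cos (phase al z w - pi / 2 - e)).
  have f1 := ler_wpM2r s1 g1; have f2 := ler_wpM2r s2 g2.
  have f3 := ler_wpM2l (expR_ge0 (- (al * T1))) H.
  lra.
under eq_integral do rewrite EFinD.
rewrite ge0_integralD //.
- have -> : 2 * M = M + M by ring.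
  by rewrite EFinD; apply: leeD; rewrite -berezinE.
- by move=> w _; rewrite lee_fin berezin_integrand_ge0.
- by apply/measurable_EFinP; exact: (continuous_plane_measurable (@cont_berezin al z)).
- by move=> w _; rewrite lee_fin berezin_integrand_ge0.
- by apply/measurable_EFinP; exact: (continuous_plane_measurable (@cont_berezin al z')).
Qed.

End equivalence.

Unset Implicit Arguments.

Theorem theorem2p1 (R : realType) (alpha : R) (halpha : 0 < alpha)
  (mu : {measure set (plane R) -> \bar R}) (p r : R) (hp : 1 <= p) (hr : 0 < r)
  (a : nat -> R * R) (ha : set_bij [set n | (0 < n)%N] (square_lattice r) a) :
  [<-> exists C : R, (forall z, (mu (disc z r) <= C%:E)%E) /\
         (forall n, (0 < n)%N -> (mu (disc (a n) r) <= C%:E)%E);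
       exists C : R, 0 < C /\
         forall f, harmonic_fock alpha p f ->
           (\int[mu]_w weighted_pow alpha p f w
            <= C%:E * \int[area R]_w weighted_pow alpha p f w)%E;
       exists M : R, forall z, (berezin alpha mu z <= M%:E)%E].
Proof.
have b0 : 0 < p * alpha / 2 by rewrite divr_gt0 // mulr_gt0 // (lt_le_trans ltr01).
tfae.
- move=> [C [muC _]].
  have [K [K0 H]] := carleson_embedding halpha hr hp (ex_intro _ C muC).
  by exists K; split => // f [hf _]; exact: H.
- move=> /(gaussian_mass_of_embedding halpha hp).
  move=> /(disc_mass_of_gaussian_mass b0 hr) muC.
  have p2 : 1 <= 2 :> R by rewrite ler1n.
  have [K [K0 H]] := carleson_embedding halpha hr p2 muC.
  have [K2 G] : exists K : R, forall z,
      (\int[mu]_w (expR (- (2 * alpha / 2 * sqdist w z)))%:E <= K%:E)%E.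
    apply: (gaussian_mass_of_embedding halpha p2).
    by exists K; split => // f [hf _]; exact: H.
  have E : 2 * alpha / 2 = alpha by field.
  exists (2 * K2) => z; apply: (le_trans (berezin_le_gaussian _ _ _)).
  by rewrite EFinM lee_wpmul2l // -{1}E; exact: G.
- move=> /(disc_mass_of_berezin halpha hr)[C muC].
  by exists C; split => [|n _]; exact: muC.
Qed.
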